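(* Let $G$ be a finite solvable group, and let $\chi \in \operatorname{Irr}(G)$ be a fully factorizable character such that either $\chi$ is $2$-rational or $\chi(1)$ is odd. Then there exists $g \in G$ such that $\mathbb{Q}(\chi(g)) = \mathbb{Q}(\chi)$.
   Context: All groups are finite and characters are complex-valued; $\operatorname{Irr}(G)$ is the set of irreducible complex characters of $G$. For a character $\chi$ of $G$, $\mathbb{Q}(\chi)$ is the field generated over $\mathbb{Q}$ by all values $\chi(g)$, $g\in G$. For a positive integer $n$, $\mathbb{Q}_n = \mathbb{Q}(e^{2\pi i/n})$. The character $\chi$ is $2$-rational if $\mathbb{Q}(\chi) \subseteq \mathbb{Q}_m$ for some odd positive integer $m$. For a prime $p$ and a finite solvable group $G$, a character $\psi \in \operatorname{Irr}(G)$ is $p$-special if $\psi(1)$ is a power of $p$ and, for every subnormal subgroup $S$ of $G$ and every irreducible constituent $\theta$ of the restriction $\psi_S$, the determinantal order $o(\theta)$ (the order of the linear character $\det\theta$ in the group of linear characters of $S$) is a power of $p$ (here $1$ counts as a power of $p$). Let $\pi(G)$ be the set of prime divisors of $|G|$. A character $\chi \in \operatorname{Irr}(G)$ is fully factorizable if $\chi = \prod_{p \in \pi(G)} \chi_p$, where each $\chi_p \in \operatorname{Irr}(G)$ is $p$-special. *)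

(* Defs.v *)
(* Library: Mathematical Components. Characters take values in algC, the
   algebraic complex numbers, which contain all character values. *)
From HB Require Import structures.
From mathcomp Require Import all_boot all_order all_algebra.
From mathcomp Require Import all_fingroup all_solvable all_field all_character.

Set Implicit Arguments.
Unset Strict Implicit.
Unset Printing Implicit Defensive.

Import Order.TTheory GRing.Theory Num.Theory.

Local Open Scope ring_scope.

(* The subfield of algC generated by A. It contains Q, the prime field, and
   division by 0 is harmless since x / 0 = 0. *)
Inductive Qadjoin (A : algC -> Prop) : algC -> Prop :=
| Qadjoin_gen x : A x -> Qadjoin A x
| Qadjoin_1 : Qadjoin A 1
| Qadjoin_sub x y : Qadjoin A x -> Qadjoin A y -> Qadjoin A (x - y)
| Qadjoin_mul x y : Qadjoin A x -> Qadjoin A y -> Qadjoin A (x * y)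
| Qadjoin_inv x : Qadjoin A x -> Qadjoin A x^-1.

Definition Qelt (a : algC) : algC -> Prop := Qadjoin (fun x => x = a).

Definition Qchar (gT : finGroupType) (G : {group gT}) (chi : 'CF(G)) :
  algC -> Prop :=
  Qadjoin (fun x => exists2 g, g \in G & x = chi g).

(* The cyclotomic field Q_m is Q(w) for any primitive m-th root of unity w;
   w plays the role of exp(2 i pi / m). An odd m is positive. *)
Definition two_rational (gT : finGroupType) (G : {group gT}) (chi : 'CF(G)) :
  Prop :=
  exists m : nat, exists w : algC,
    [/\ odd m, m.-primitive_root w & forall x, Qchar chi x -> Qelt w x].

Definition p_special (gT : finGroupType) (G : {group gT}) (p : nat)
  (psi : 'CF(G)) : Prop :=
  [/\ psi \in irr G,
      exists k : nat, psi 1%g = (p ^ k)%:R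
    & forall S : {group gT}, (S <|<| G)%g ->
      forall i : Iirr S, i \in irr_constt ('Res[S] psi) ->
      exists k : nat, ('o('chi_i))%CF = (p ^ k)%N].

(* Only the values psi p with p a prime divisor of #|G| matter. *)
Definition fully_factorizable (gT : finGroupType) (G : {group gT})
  (chi : 'CF(G)) : Prop :=
  exists psi : nat -> 'CF(G),
    (forall p, p \in \pi(G) -> p_special p (psi p))
    /\ chi = \prod_(p <- primes #|G|) psi p.

(* Main.v *)
From Stdlib Require Import Classical.
Require Import Defs.
From HB Require Import structures.
From mathcomp Require Import all_boot all_order all_algebra.
From mathcomp Require Import all_fingroup all_solvable all_field all_character.
From mathcomp Require Import ring.

Set Implicit Arguments.
Unset Strict Implicit.
Unset Printing Implicit Defensive.

Import Order.TTheory GRing.Theory Num.Theory.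

Local Open Scope group_scope.
Local Open Scope ring_scope.

(** Write chi as the product of p-special characters chi_p. An automorphism u
of the complex algebraic numbers fixes the value chi(g) exactly when the
ratios r_p = u(chi_p(g)) / chi_p(g) have product 1, provided that chi(g) is
not 0. Since chi_p has values in the cyclotomic field of order |G|_p, r_p
lies both in that field and in the one of order |G|_p', so r_p is rational.
By [Qelt_descent] it is therefore enough to find g such that
 - for p odd, an automorphism that multiplies chi_p(g) by a rational number
   fixes chi_p ([robust_value]); then r_p = 1;
 - an automorphism that fixes chi_2(g) fixes chi_2 ([determined_at]); this
   suffices because r_2 = 1 once all the other ratios are 1.
This reduction is [galois_determining_value].

Two properties of special characters are used. Inner products of products of
special characters for disjoint sets of primes are the products of the inner
products ([cfdot_special_prod]), so that such products are irreducible and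
have unique factors; and restriction to a Sylow p-subgroup is isometric on
p-special characters ([cfdot_Res_Sylow]), which bounds their field of values.
Both are proved by induction through a normal subgroup M of prime index: the
inner product of restrictions to M is a sum over the linear characters of
G / M ([sum_cfdot_lin_quo]), two such sums agree by induction, and they are
comparable term by term, hence equal term by term.

For odd p, an automorphism that fixes chi_p(g) up to a rational factor is
controlled in two steps. The automorphisms that fix the p-th roots of unity
induce a cyclic p-group on the roots of unity of p-power order, so that its
subgroups form a chain: a single automorphism sigma has the property that
chi_p(g) <> sigma(chi_p(g)) makes chi_p(g) detect all of them
([wild_value_detector]). The functions L_p = chi_p - sigma(chi_p), or L_p = chi_p
if these automorphisms all fix chi_p, have a nonzero product, so some g is good
for all p at once. For the other automorphisms, let zeta be a primitive p-th
root of 1 and a <> 0 a cyclotomic number. Among a and zeta a, at least one is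
such that the automorphisms multiplying it by a rational number all fix zeta
([pins_roots_or]). Hence at worst g has to be replaced by an element where
chi_p takes the value zeta chi_p(g), without spoiling the other primes.

The primes are adjusted one after the other, in a suitable order. Let R be a
nonempty set of odd primes q with chi_q nontrivial, and let D be the common
kernel of these chi_q. A minimal normal subgroup N / D of G / D is a p-group
for some p in R, lies in the kernel of chi_q for the other q in R, and contains
an element z on which chi_p is the scalar zeta ([special_central_section]). So
p is adjusted after the other primes of R: multiplying g by an element of zD
changes chi_p(g) as desired and preserves the other chi_q(g) with q in R. The
odd primes outside R are adjusted later still, and until then only the
nonvanishing of their L_q matters. If f is a combination of special characters
for primes outside R, then f is nonzero somewhere on gzD as soon as f(g) <> 0
([special_span_coset_neq0]): the restriction to gN of |f|^2 has the same sum on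
all cosets of D, because |f|^2 involves no nontrivial linear character of N / D.
An induction on R, where f is the product of the L_q for q outside R, including
a function L_2 that detects chi_2 ([two_part_detector]), gives the required g
([robust_values_exist]).

For p = 2 the relevant Galois group is not cyclic. This is where the
alternative in the hypothesis enters: if chi is 2-rational then chi_2 is fixed
by every automorphism, and if chi(1) is odd then chi_2 is linear. *)

(** * Special characters and normal subgroups of prime index *)

Section RestrictionSums.

Variables (gT : finGroupType) (G M : {group gT}).
Hypotheses (nsMG : M <| G) (abGM : abelian (G / M)).

Lemma sum_lin_quoE x :
  x \in G -> \sum_(l : Iirr (G / M)) ('chi_l %% M)%CF x = #|G : M|%:R *+ (x \in M).
Proof.
move=> Gx; have -> : (x \in M) = (coset M x == 1%g).
  apply/idP/eqP => [/coset_id // | /coset_idr -> //].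
  by rewrite (subsetP (normal_norm nsMG)).
transitivity (cfReg (G / M) (coset M x)).
  rewrite cfReg_sum sum_cfunE; apply: eq_bigr => l _.
  by rewrite cfModE // cfunE lin_char1 ?mul1r //; exact/char_abelianP.
by rewrite cfRegE card_quotient ?normal_norm.
Qed.

(** The sum of the linear characters of [G / M] is the regular character of
[G / M]. Having this for a subgroup [H] that covers [G / M] lets the sums for
[G] and for a Sylow subgroup be compared. *)
Lemma sum_cfdot_lin_quo (H : {group gT}) (phi psi : 'CF(G)) :
    H \subset G -> (H * M)%g = G ->
  \sum_(l : Iirr (G / M)) '['Res[H] phi, 'Res[H] (('chi_l %% M)%CF * psi)]
    = '['Res[H :&: M] phi, 'Res[H :&: M] psi].
Proof.
move=> sHG defG; have sMG := normal_sub nsMG.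
have sHMG : H :&: M \subset G by rewrite subIset ?sHG.
have oG : (#|G : M| * #|H :&: M| = #|H|)%N.
  apply/eqP; rewrite -(eqn_pmul2r (cardG_gt0 M)) mulnAC mul_cardG defG.
  by rewrite -(Lagrange sMG) [(#|M| * _)%N]mulnC.
rewrite !cfdotE /=.
transitivity (#|H|%:R^-1 * (\sum_(x in H) phi x * (psi x)^* *
                (\sum_(l : Iirr (G / M)) ('chi_l %% M)%CF x)^*)).
  rewrite -mulr_sumr; congr (_ * _); rewrite exchange_big /=.
  apply: eq_bigr => x Hx; have Gx := subsetP sHG x Hx.
  rewrite rmorph_sum mulr_sumr; apply: eq_bigr => l _.
  by rewrite !cfResE // cfunE rmorphM /= [_^* * _]mulrC mulrA.
have -> : #|H :&: M|%:R^-1 = #|H|%:R^-1 * #|G : M|%:R :> algC.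
  by rewrite -oG natrM invfM mulrAC mulVf ?mul1r // pnatr_eq0 -lt0n indexg_gt0.
rewrite -mulrA [X in _ = _ * X]mulr_sumr; congr (_ * _).
rewrite [in RHS]big_mkcond [in LHS]big_mkcond /=; apply: eq_bigr => x _; rewrite inE.
case: (boolP (x \in H)) => //= Hx; have Gx := subsetP sHG x Hx.
rewrite sum_lin_quoE //; case: (boolP (x \in M)) => Mx; last first.
  by rewrite conjC0 mulr0.
by rewrite !cfResE ?inE ?Hx // mulr1n conjC_nat mulrC.
Qed.

End RestrictionSums.

Section Special.

Implicit Types (gT : finGroupType) (pi rho : nat_pred).

(** This is the notion of a [pi]-special character for a set [pi] of primes;
sets of several primes occur when all but one of the factors are grouped. *)
Definition pi_special gT (G : {group gT}) pi (i : Iirr G) : Prop :=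
  pi.-nat (Num.truncn ('chi_i 1%g))
  /\ forall S : {group gT}, S <|<| G ->
       forall j : Iirr S, j \in irr_constt ('Res[S] 'chi_i) ->
       pi.-nat ('o('chi_j))%CF.

(** The vector space spanned by the [pi]-special characters. *)
Definition special_span gT (G : {group gT}) pi (f : 'CF(G)) : Prop :=
  forall i, i \in irr_constt f -> pi_special pi i.

Lemma pi_special_span gT (G : {group gT}) pi (i : Iirr G) :
  pi_special pi i -> special_span pi 'chi_i.
Proof. by move=> pi_i j; rewrite constt_irr => /eqP->. Qed.

Lemma special_span_sub gT (G : {group gT}) pi rho (f : 'CF(G)) :
  {subset pi <= rho} -> special_span pi f -> special_span rho f.
Proof.
move=> sub_pi f_pi i /f_pi[deg_i ord_i]; split=> [|S nnS j /(ord_i S nnS)].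
  by apply: sub_in_pnat deg_i => p _ /sub_pi.
by apply: sub_in_pnat => p _ /sub_pi.
Qed.

Lemma constt_Res_ex gT (G S : {group gT}) (f : 'CF(G)) j :
    j \in irr_constt ('Res[S] f) ->
  exists2 i, i \in irr_constt f & j \in irr_constt ('Res[S] 'chi_i).
Proof.
rewrite {1}[f]cfun_sum_constt linear_sum irr_consttE cfdot_suml => nz_j.
have [i /andP[f_i nz_ij]] : exists i, (i \in irr_constt f)
    && ('['Res[S] ('[f, 'chi_i] *: 'chi_i), 'chi_j] != 0).
  apply/existsP; apply: contraNT nz_j; rewrite negb_exists => /forallP nz_j.
  rewrite big1 // => i f_i; apply/eqP; move: (nz_j i).
  by rewrite f_i /= negbK.
exists i => //; apply: contraNneq nz_ij => ij0.
by rewrite linearZ cfdotZl ij0 mulr0.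
Qed.

Lemma pi_special_constt_Res gT (G M : {group gT}) pi (i : Iirr G) (j : Iirr M) :
    M <| G -> pi_special pi i -> j \in irr_constt ('Res[M] 'chi_i) ->
  pi_special pi j.
Proof.
move=> nsMG [deg_i ord_i] Mj; have sMG := normal_sub nsMG; split.
  apply: pnat_dvd deg_i; have [n Dn] := dvdn_constt_Res1_irr1 nsMG Mj.
  have /natrP[d Dd] := Cnat_irr1 j; move: Dn; rewrite Dd -natrM => ->.
  by rewrite !natrK dvdn_mull.
move=> S nnSM k Sk; have nnSG := subnormal_trans nnSM (normal_subnormal nsMG).
apply: (ord_i S nnSG).
rewrite -(cfResRes _ (subnormal_sub nnSM) sMG).
by apply: constt_Res_trans Sk; rewrite ?cfRes_char ?irr_char.
Qed.

Lemma special_span_Res_normal gT (G M : {group gT}) pi (f : 'CF(G)) :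
  M <| G -> special_span pi f -> special_span pi ('Res[M] f).
Proof.
move=> nsMG f_pi j /constt_Res_ex[i /f_pi pi_i].
exact: pi_special_constt_Res.
Qed.

Lemma special_span_Res gT (G S : {group gT}) pi (f : 'CF(G)) :
  S <|<| G -> special_span pi f -> special_span pi ('Res[S] f).
Proof.
have [n] := ubnP #|G|; elim: n => // n IHn in G S f * => leGn nnSG f_pi.
have [/val_inj eSG | [K [nnSK nsKG prKG]]] := subnormalEr nnSG.
  by rewrite eSG cfRes_id.
rewrite -(cfResRes _ (subnormal_sub nnSK) (normal_sub nsKG)).
apply: IHn nnSK _; last exact: special_span_Res_normal.
by rewrite (leq_trans (proper_card prKG)).
Qed.

Lemma pi_special_lin gT (G : {group gT}) pi (i : Iirr G) :
  'chi_i \is a linear_char -> pi.-nat #['chi_i]%CF -> pi_special pi i.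
Proof.
move=> lin_i pi_i; split; first by rewrite lin_char1 // truncn1.
move=> S nnSG j; have sSG := subnormal_sub nnSG.
have lin_Si := cfRes_lin_char S lin_i.
have [k Dk] := irrP (lin_char_irr lin_Si).
rewrite Dk constt_irr => /eqP->; rewrite -Dk cfDet_order_lin //.
apply: pnat_dvd pi_i; apply/dvdn_cforderP => x Sx.
rewrite cfResE //; apply/dvdn_cforderP => //; exact: (subsetP sSG).
Qed.

Lemma pi_special0 gT (G : {group gT}) pi : pi_special pi (0 : Iirr G).
Proof.
apply: pi_special_lin; rewrite irr0 ?cfun1_lin_char //.
by apply: (@pnat_dvd _ 1); rewrite // dvdn_cforder expr1n.
Qed.

Lemma pi_special_det gT (G : {group gT}) pi (i : Iirr G) :
  pi_special pi i -> pi.-nat ('o('chi_i))%CF.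
Proof.
case=> _ ord_i; apply: (ord_i G (subnormal_refl G)).
by rewrite cfRes_id constt_irr inE.
Qed.

(** Taking determinants of ['chi_i = lam * 'chi_k] expresses [lam ^+ 'chi_k 1]
by characters of [pi]-order, while the order of [lam] is prime to both [pi] and
['chi_k 1]. *)
Lemma pi_special_mul_lin gT (G : {group gT}) pi (i k : Iirr G) (lam : 'CF(G)) :
    pi_special pi i -> pi_special pi k -> lam \is a linear_char ->
    pi^'.-nat #[lam]%CF -> 'chi_i = lam * 'chi_k -> lam = 1.
Proof.
move=> pi_i pi_k lin_lam pi'lam Dik.
have [pi_det_i pi_det_k] := (pi_special_det pi_i, pi_special_det pi_k).
have [[pi_d _] _] := (pi_k, pi_i).
set d := Num.truncn _ in pi_d.
have Ddet : cfDet 'chi_i = lam ^+ d * cfDet 'chi_k.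
  by rewrite Dik cfDet_mul_lin ?irr_char.
set m := ('o('chi_i)%CF * 'o('chi_k)%CF)%N.
have lam1 : lam ^+ (d * m) = 1.
  have /eqP Di1 : cfDet 'chi_i ^+ m == 1 by rewrite -dvdn_cforder dvdn_mulr.
  have /eqP Dk1 : cfDet 'chi_k ^+ m == 1 by rewrite -dvdn_cforder dvdn_mull.
  by rewrite -Di1 Ddet exprMn Dk1 mulr1 exprM.
apply/eqP; rewrite -[lam]expr1 -dvdn_cforder dvdn1.
have: (#[lam]%CF %| d * m)%N by rewrite dvdn_cforder lam1.
have co : coprime #[lam]%CF (d * m).
  by rewrite coprime_sym; apply: pnat_coprime pi'lam; rewrite !pnatM pi_d pi_det_i.
by move/gcdn_idPl; rewrite (eqP co) => <-.
Qed.

Section PrimeIndex.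

Variables (gT : finGroupType) (G M : {group gT}).
Hypotheses (nsMG : M <| G) (pr_iM : prime #|G : M|).

Lemma abelian_prime_quo : abelian (G / M).
Proof.
by apply/cyclic_abelian/prime_cyclic; rewrite card_quotient ?normal_norm.
Qed.

Lemma lin_quo (l : Iirr (G / M)) : ('chi_l %% M)%CF \is a linear_char.
Proof. exact/cfMod_lin_char/char_abelianP/abelian_prime_quo. Qed.

Lemma lin_quo_order (l : Iirr (G / M)) : (#['chi_l %% M]%CF %| #|G : M|)%N.
Proof.
have lin_l : 'chi_l \is a linear_char by apply/char_abelianP/abelian_prime_quo.
apply/dvdn_cforderP=> x Gx; rewrite cfModE // -lin_charX ?mem_quotient //.
rewrite -card_quotient ?normal_norm // expg_cardG ?mem_quotient //.
exact: lin_char1.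
Qed.

(** In [sum_cfdot_lin_quo] only the trivial linear character of [G / M] can
contribute, by [pi_special_mul_lin]. *)
Lemma cfdot_Res_special_pi' pi (f e : 'CF(G)) :
    #|G : M| \notin pi -> special_span pi f -> special_span pi e ->
  '['Res[M] f, 'Res[M] e] = '[f, e].
Proof.
move=> pi'q f_pi e_pi.
have defG : (G * M)%g = G by rewrite mulGSid ?normal_sub.
rewrite [e]cfun_sum_constt [f]cfun_sum_constt !linear_sum !cfdot_sumr.
apply: eq_bigr => k /e_pi pi_k; rewrite !cfdot_suml.
apply: eq_bigr => i /f_pi pi_i; rewrite !linearZ !cfdotZl !cfdotZr /=.
congr (_ * (_ * _)).
have := sum_cfdot_lin_quo nsMG abelian_prime_quo 'chi_i 'chi_k (subxx G) defG.
rewrite /= (setIidPr (normal_sub nsMG)) => <-.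
rewrite (bigD1 0) //= irr0 cfMod_cfun1 mul1r !cfRes_id big1 ?addr0 //.
move=> l nz_l; rewrite !cfRes_id.
have /irrP[k' Dk'] : ('chi_l %% M)%CF * 'chi_k \in irr G.
  by rewrite mul_lin_irr ?lin_quo ?mem_irr.
rewrite Dk' cfdot_irr; case: eqP => // Dik; case/eqP: nz_l.
apply: irr_inj; apply/eqP; rewrite irr0 -(cfMod_eq1 _ nsMG); apply/eqP.
apply: pi_special_mul_lin pi_i pi_k (lin_quo l) _ _; last by rewrite Dk' Dik.
by apply: pnat_dvd (lin_quo_order l) _; rewrite pnatE.
Qed.

End PrimeIndex.

Lemma cfdot_char_ge1 gT (G : {group gT}) (f : 'CF(G)) :
  f \is a character -> f != 0 -> 1 <= '[f].
Proof.
move=> Nf nz_f; have /natrP[n Dn] : '[f] \in Num.nat by rewrite Cnat_cfdot_char.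
by rewrite Dn ler1n lt0n -eqC_nat -Dn cfnorm_eq0.
Qed.

(** Gajendragadkar's theorem. For a normal subgroup [M] of prime index, one of
the two families restricts isometrically to [M] ([cfdot_Res_special_pi']), so
by induction the sum over [l] of the inner products of
['chi_a * 'chi_b] and [l * 'chi_a' * 'chi_b'] equals the sum of the products
['['chi_a, l * 'chi_a'] * '['chi_b, 'chi_b']]. The second sum is dominated
termwise by the first one, hence they agree at [l = 1]. *)
Lemma cfdot_special_prod gT (G : {group gT}) pi rho (f f' e e' : 'CF(G)) :
    solvable G -> {in pi, forall p, p \notin rho} ->
    special_span pi f -> special_span pi f' ->
    special_span rho e -> special_span rho e' ->
  '[f * e, f' * e'] = '[f, f'] * '[e, e'].
Proof.
have [n] := ubnP #|G|.
elim: n => // n IHn in gT G pi rho f f' e e' * => leGn solG dis.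
(* By multilinearity only irreducible characters matter. *)
have reduce : (forall i i' j j' : Iirr G, pi_special pi i -> pi_special pi i' ->
     pi_special rho j -> pi_special rho j' ->
     '['chi_i * 'chi_j, 'chi_i' * 'chi_j'] = '['chi_i, 'chi_i'] * '['chi_j, 'chi_j']) ->
   special_span pi f -> special_span pi f' ->
   special_span rho e -> special_span rho e' ->
  '[f * e, f' * e'] = '[f, f'] * '[e, e'].
  move=> irr_case f_pi f'_pi e_rho e'_rho.
  rewrite {1 2}[f]cfun_sum_constt !mulr_suml !cfdot_suml mulr_suml.
  apply: eq_bigr => i /f_pi pi_i; rewrite -scalerAl !cfdotZl.
  rewrite -[RHS]mulrA; move: '[f, 'chi_i] => c; congr (c * _).
  rewrite {1 2}[f']cfun_sum_constt !mulr_suml !cfdot_sumr mulr_suml.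
  apply: eq_bigr => i' /f'_pi pi_i'; rewrite -scalerAl !cfdotZr.
  rewrite -[RHS]mulrA; move: '[f', 'chi_i']^* => c'; congr (c' * _).
  rewrite {1 2}[e]cfun_sum_constt !mulr_sumr !cfdot_suml mulr_sumr.
  apply: eq_bigr => j /e_rho rho_j; rewrite -scalerAr !cfdotZl.
  rewrite [RHS]mulrCA; move: '[e, 'chi_j] => d; congr (d * _).
  rewrite {1 2}[e']cfun_sum_constt !mulr_sumr !cfdot_sumr mulr_sumr.
  apply: eq_bigr => j' /e'_rho rho_j'; rewrite -scalerAr !cfdotZr.
  rewrite [RHS]mulrCA; move: '[e', 'chi_j']^* => d'; congr (d' * _).
  exact: irr_case.
apply: reduce => {f f' e e'} i i' j j' pi_i pi_i' rho_j rho_j'.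
have [G1 | ntG] := eqVneq (G : {set gT}) 1%g.
  have lin1 (k : Iirr G) : 'chi_k = 1.
    have lin_k : 'chi_k \is a linear_char by rewrite irr_cyclic_lin // G1 cyclic1.
    apply/cfun_inP=> x; rewrite {1}G1 => /set1P->.
    by rewrite lin_char1 // cfun1E group1.
  by rewrite !lin1 mulr1 cfnorm1 mulr1.
have [M nsMG pr_iM] := sol_prime_factor_exists solG ntG.
have leMn : (#|M| < n)%N.
  rewrite -ltnS; apply: leq_trans leGn; rewrite ltnS -(Lagrange (normal_sub nsMG)).
  by rewrite ltn_Pmulr ?prime_gt1.
have defG : (G * M)%g = G by rewrite mulGSid ?normal_sub.
have abGM := abelian_prime_quo nsMG pr_iM.
have sumE phi psi := sum_cfdot_lin_quo nsMG abGM phi psi (subxx G) defG.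
rewrite /= (setIidPr (normal_sub nsMG)) in sumE.
have core sigma tau (a a' b b' : Iirr G) :
    {in sigma, forall p, p \notin tau} -> #|G : M| \notin tau ->
    pi_special sigma a -> pi_special sigma a' ->
    pi_special tau b -> pi_special tau b' ->
  '['chi_a * 'chi_b, 'chi_a' * 'chi_b'] = '['chi_a, 'chi_a'] * '['chi_b, 'chi_b'].
- move=> dis' tau'q s_a s_a' t_b t_b'.
  pose lhs (l : Iirr (G / M)) :=
    '['chi_a * 'chi_b, ('chi_l %% M)%CF * 'chi_a' * 'chi_b'].
  pose rhs (l : Iirr (G / M)) :=
    '['chi_a, ('chi_l %% M)%CF * 'chi_a'] * '['chi_b, 'chi_b'].
  have le_rl l : rhs l <= lhs l.
    rewrite /rhs /lhs; set lam := ('chi_l %% M)%CF.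
    have lin_lam : lam \is a linear_char by apply: lin_quo.
    have /irrP[c Dc] : lam * 'chi_a' \in irr G by rewrite mul_lin_irr ?mem_irr.
    rewrite Dc !cfdot_irr; case: eqP => [<-|_]; last first.
      by rewrite mul0r natr_ge0 ?Cnat_cfdot_char ?rpredM ?irr_char.
    case: eqP => [<-|_]; last first.
      by rewrite mulr0 natr_ge0 ?Cnat_cfdot_char ?rpredM ?irr_char.
    rewrite mulr1 cfdot_char_ge1 ?rpredM ?irr_char //.
    rewrite -char1_eq0 ?rpredM ?irr_char // cfunE.
    by rewrite mulf_neq0 ?irr1_neq0.
  (* Restriction to [M] is isometric on the [tau]-special characters, and the
  induction hypothesis applies in [M]. *)
  have sum_eq : \sum_l lhs l = \sum_l rhs l.
    rewrite /rhs -mulr_suml -(cfdot_Res_special_pi' nsMG pr_iM tau'q);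
      try exact: pi_special_span.
    have:= sumE 'chi_a 'chi_a'; under eq_bigr do rewrite !cfRes_id.
    move=> ->; have:= sumE ('chi_a * 'chi_b) ('chi_a' * 'chi_b').
    under eq_bigr do rewrite !cfRes_id mulrA.
    move=> ->; rewrite !rmorphM.
    apply: (IHn _ _ sigma tau) => //; first exact: solvableS (normal_sub nsMG) _;
      by apply: special_span_Res_normal => //; exact: pi_special_span.
  have eq0 : lhs 0 - rhs 0 = 0.
    have/psumr_eq0P-> //: \sum_l (lhs l - rhs l) = 0.
      by rewrite sumrB sum_eq subrr.
    by move=> l _; rewrite subr_ge0.
  move/eqP: eq0; rewrite subr_eq0 /lhs /rhs irr0 cfMod_cfun1 !mul1r.
  by move/eqP.
have [rho_q | rho'q] := boolP (#|G : M| \in rho); last exact: (core pi rho).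
rewrite ![_ * 'chi_j]mulrC ![_ * 'chi_j']mulrC [RHS]mulrC.
apply: (core rho pi) => // [p rho_p|]; first by apply: contraL rho_p => /dis.
by apply: contraL rho_q => /dis.
Qed.

End Special.

(** * Products and Sylow restrictions of special characters *)

(** On a cyclic subgroup [psi] is a sum of linear characters, which reduces
the claim to the product of a character with a linear one. *)
Lemma cfDet_mul gT (G : {group gT}) (phi psi : 'CF(G)) :
    phi \is a character -> psi \is a character ->
  cfDet (phi * psi)
    = cfDet phi ^+ Num.truncn (psi 1%g) * cfDet psi ^+ Num.truncn (phi 1%g).
Proof.
move=> Nphi Npsi; apply/cfun_inP=> x Gx.
have sxG : <[x]> \subset G by rewrite cycle_subG.
have detE (theta : 'CF(G)) : theta \is a character ->
    cfDet theta x = cfDet ('Res[<[x]>] theta) x.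
  by move=> Ntheta; rewrite cfDetRes // cfResE ?cycle_id.
rewrite detE ?rpredM // cfunE !exp_cfunE // !detE //.
rewrite -(cfRes1 <[x]> psi) -(cfRes1 <[x]> phi) rmorphM /=.
have := cfRes_char <[x]> Npsi; have := cfRes_char <[x]> Nphi.
move: ('Res phi) ('Res psi) => {Nphi Npsi detE} {}phi {}psi Nphi Npsi.
suffices -> : cfDet (phi * psi) = cfDet phi ^+ Num.truncn (psi 1%g)
                                  * cfDet psi ^+ Num.truncn (phi 1%g).
  by rewrite cfunE !exp_cfunE ?cycle_id.
have [r ->] := char_sum_irr Npsi; elim: r => [|i r IHr].
  by rewrite !big_nil mulr0 !cfDet0 cfunE truncn0 expr0 expr1n mulr1.
have lin_i : 'chi_i \is a linear_char by rewrite irr_cyclic_lin ?cycle_cyclic.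
have Nr : \sum_(j <- r) 'chi_j \is a character.
  by apply: rpred_sum => j _; apply: irr_char.
rewrite !big_cons mulrDr !cfDetD ?rpredM ?irr_char // IHr.
rewrite [('chi_i + _) 1%g]cfunE (lin_char1 lin_i) [phi * _]mulrC.
rewrite cfDet_mul_lin // (cfDet_id lin_i) exprMn truncnD ?nnegrE ?char1_ge0 //.
by rewrite truncn1 exprD expr1 [RHS]mulrACA [cfDet phi * _]mulrC.
Qed.

Lemma constt_mul_ex gT (G : {group gT}) (f e : 'CF(G)) k :
    k \in irr_constt (f * e) ->
  exists i j, [/\ i \in irr_constt f, j \in irr_constt e
                & k \in irr_constt ('chi_i * 'chi_j)].
Proof.
rewrite {1}[f]cfun_sum_constt {1}[e]cfun_sum_constt irr_consttE => nz_k.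
have [i /andP[f_i /existsP[j /andP[e_j nz_ij]]]] :
    exists i, (i \in irr_constt f) && [exists j, (j \in irr_constt e)
      && ('['chi_i * 'chi_j, 'chi_k] != 0)].
  apply/existsP; apply: contraNT nz_k => /existsPn nz.
  rewrite mulr_suml cfdot_suml big1 // => i f_i.
  rewrite mulr_sumr cfdot_suml big1 // => j e_j.
  have:= nz i; rewrite f_i => /existsPn/(_ j); rewrite e_j negbK => /eqP nz_ij.
  by rewrite -scalerAl -scalerAr !cfdotZl nz_ij !mulr0.
by exists i, j.
Qed.

Lemma special_mul_irr gT (G : {group gT}) pi rho (i j : Iirr G) :
    solvable G -> {in pi, forall p, p \notin rho} ->
    pi_special pi i -> pi_special rho j ->
  'chi_i * 'chi_j \in irr G.
Proof.
move=> solG dis pi_i rho_j.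
have [i_span j_span] := (pi_special_span pi_i, pi_special_span rho_j).
rewrite irrEchar rpredM ?irr_char //=.
by rewrite (cfdot_special_prod solG dis) ?cfnorm_irr ?mulr1.
Qed.

Lemma special_span_mul_neq0 gT (G : {group gT}) pi rho (f e : 'CF(G)) :
    solvable G -> {in pi, forall p, p \notin rho} ->
    special_span pi f -> special_span rho e -> f != 0 -> e != 0 ->
  f * e != 0.
Proof.
move=> solG dis f_pi e_rho nz_f nz_e.
rewrite -cfnorm_eq0 (cfdot_special_prod solG dis) //.
by rewrite mulf_neq0 ?cfnorm_eq0.
Qed.

Lemma special_span_mul gT (G : {group gT}) pi rho (f e : 'CF(G)) :
    solvable G -> {in pi, forall p, p \notin rho} ->
    special_span pi f -> special_span rho e ->
  special_span [predU pi & rho] (f * e).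
Proof.
move=> solG dis f_pi e_rho k /constt_mul_ex[i [j [/f_pi pi_i /e_rho rho_j]]].
have sub_pi : {subset pi <= [predU pi & rho]} by move=> p /= pi_p; apply/orP; left.
have sub_rho : {subset rho <= [predU pi & rho]} by move=> p /= rho_p; apply/orP; right.
have natl m : pi.-nat m -> [predU pi & rho].-nat m.
  by apply: sub_in_pnat => p _ /sub_pi.
have natr m : rho.-nat m -> [predU pi & rho].-nat m.
  by apply: sub_in_pnat => p _ /sub_rho.
have /irrP[k' Dk] := special_mul_irr solG dis pi_i rho_j.
rewrite Dk constt_irr => /eqP->; rewrite {k}.
have [[deg_i _] [deg_j _]] := (pi_i, rho_j).
split=> [|S nnSG c].
  rewrite -Dk cfunE truncnM ?nnegrE ?irr1_ge0 ?Cnat_irr1 //.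
  by rewrite pnatM natl ?natr.
have solS := solvableS (subnormal_sub nnSG) solG.
have i_S := special_span_Res nnSG (pi_special_span pi_i).
have j_S := special_span_Res nnSG (pi_special_span rho_j).
rewrite -Dk rmorphM => /constt_mul_ex[a [b [/i_S pi_a /j_S rho_b]]].
have /irrP[c' Dc] := special_mul_irr solS dis pi_a rho_b.
rewrite Dc constt_irr => /eqP->; rewrite -Dc.
have [pi_da rho_db] := (pi_special_det pi_a, pi_special_det rho_b).
have pr_nat : [predU pi & rho].-nat ('o('chi_a)%CF * 'o('chi_b)%CF)%N.
  by rewrite pnatM natl ?natr.
apply: pnat_dvd pr_nat; rewrite dvdn_cforder cfDet_mul ?irr_char //.
rewrite exprMn -!exprM mulnCA.
have /eqP a1 : cfDet 'chi_a ^+ 'o('chi_a)%CF == 1 by rewrite -dvdn_cforder.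
have /eqP b1 : cfDet 'chi_b ^+ 'o('chi_b)%CF == 1 by rewrite -dvdn_cforder.
by rewrite exprM a1 expr1n mul1r mulnA mulnC exprM b1 expr1n.
Qed.

(** The argument parallels [cfdot_special_prod]. If [M] has index [p], then
the sums over [Irr (G / M)] for [P] and for [G] agree by induction applied to
[P :&: M] in [M], and the terms for [P] are at least those for [G]. If the
index is prime to [p], then [P] lies in [M]. *)
Lemma cfdot_Res_Sylow gT (G P : {group gT}) (p : nat) (f e : 'CF(G)) :
    solvable G -> p.-Sylow(G) P -> special_span p f -> special_span p e ->
  '['Res[P] f, 'Res[P] e] = '[f, e].
Proof.
have [n] := ubnP #|G|.
elim: n => // n IHn in G P f e * => leGn solG sylP.
have reduce : (forall i j : Iirr G, pi_special p i -> pi_special p j ->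
     '['Res[P] 'chi_i, 'Res[P] 'chi_j] = '['chi_i, 'chi_j]) ->
   special_span p f -> special_span p e -> '['Res[P] f, 'Res[P] e] = '[f, e].
  move=> irr_case f_p e_p.
  rewrite [f]cfun_sum_constt linear_sum !cfdot_suml.
  apply: eq_bigr => i /f_p p_i; rewrite linearZ !cfdotZl; congr (_ * _).
  rewrite [e]cfun_sum_constt linear_sum !cfdot_sumr.
  apply: eq_bigr => j /e_p p_j; rewrite linearZ !cfdotZr; congr (_ * _).
  exact: irr_case.
apply: reduce => {f e} i j p_i p_j.
have [sPG pP _] := and3P sylP.
have [G1 | ntG] := eqVneq (G : {set gT}) 1%g.
  have -> : P = G.
    by apply/val_inj/eqP; rewrite eqEsubset sPG /= G1 sub1G.
  by rewrite !cfRes_id.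
have [M nsMG pr_iM] := sol_prime_factor_exists solG ntG.
have sMG := normal_sub nsMG.
have leMn : (#|M| < n)%N.
  rewrite -ltnS; apply: leq_trans leGn; rewrite ltnS -(Lagrange sMG).
  by rewrite ltn_Pmulr ?prime_gt1.
have IH_M (Q : {group gT}) : p.-Sylow(M) Q ->
    '['Res[Q] 'chi_i, 'Res[Q] 'chi_j] = '['Res[M] 'chi_i, 'Res[M] 'chi_j].
  move=> sylQ; have sQM := pHall_sub sylQ.
  rewrite -!(cfResRes _ sQM sMG) (IHn _ _ _ _ leMn (solvableS sMG solG)) //;
    by apply: special_span_Res_normal => //; apply: pi_special_span.
have [p_iM | p'iM] := boolP (#|G : M| \in (p : nat_pred)); last first.
  have sPM : P \subset M.
    have nMP := subset_trans sPG (normal_norm nsMG).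
    rewrite -quotient_sub1 // -(setIidPl (quotientS M sPG)) coprime_TIg //.
    rewrite [#|(G / M)%g|]card_quotient ?normal_norm //.
    by apply: pnat_coprime (quotient_pgroup M pP) _; rewrite pnatE.
  rewrite IH_M; last exact: pHall_subl sylP.
  by rewrite (cfdot_Res_special_pi' nsMG pr_iM p'iM) //; apply: pi_special_span.
have p'iP : p^'.-nat #|G : P| by have /and3P[] := sylP.
have defG : (P * M)%g = G.
  apply: coprime_index_mulG => //; rewrite coprime_sym.
  by apply: pnat_coprime p'iP; rewrite pnatE.
have defG' : (G * M)%g = G by rewrite mulGSid.
have abGM := abelian_prime_quo nsMG pr_iM.
pose lhs (l : Iirr (G / M)) :=
  '['Res[P] 'chi_i, 'Res[P] (('chi_l %% M)%CF * 'chi_j)].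
pose rhs (l : Iirr (G / M)) := '['chi_i, ('chi_l %% M)%CF * 'chi_j].
have le_rl l : rhs l <= lhs l.
  rewrite /rhs /lhs; set lam := ('chi_l %% M)%CF.
  have lin_lam : lam \is a linear_char by apply: lin_quo.
  have /irrP[c ->] : lam * 'chi_j \in irr G by rewrite mul_lin_irr ?mem_irr.
  rewrite cfdot_irr; case: eqP => [<-|_]; last first.
    by rewrite natr_ge0 ?Cnat_cfdot_char ?cfRes_char ?irr_char.
  apply: cfdot_char_ge1; first by rewrite cfRes_char ?irr_char.
  by rewrite cfRes_eq0 ?irr_char // irr_neq0.
have sum_eq : \sum_l lhs l = \sum_l rhs l.
  rewrite (sum_cfdot_lin_quo nsMG abGM 'chi_i 'chi_j sPG defG).
  rewrite IH_M; last exact: Hall_setI_normal nsMG sylP.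
  have := sum_cfdot_lin_quo nsMG abGM 'chi_i 'chi_j (subxx G) defG'.
  rewrite /= (setIidPr sMG) => <-.
  by apply: eq_bigr => l _; rewrite !cfRes_id.
have eq0 : lhs 0 - rhs 0 = 0.
  have/psumr_eq0P-> //: \sum_l (lhs l - rhs l) = 0.
    by rewrite sumrB sum_eq subrr.
  by move=> l _; rewrite subr_ge0.
move/eqP: eq0; rewrite subr_eq0 /lhs /rhs irr0 cfMod_cfun1 !mul1r.
by move/eqP.
Qed.

(** * Galois action on character values *)

Lemma Qadjoin0 A : Qadjoin A 0.
Proof. by rewrite -(subrr 1); apply: Qadjoin_sub; apply: Qadjoin_1. Qed.

Lemma Qadjoin_add A x y : Qadjoin A x -> Qadjoin A y -> Qadjoin A (x + y).
Proof.
move=> Ax Ay; rewrite -[y]opprK; apply: Qadjoin_sub => //.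
by rewrite -sub0r; apply: Qadjoin_sub => //; apply: Qadjoin0.
Qed.

Lemma Qadjoin_sum A (I : Type) (r : seq I) (F : I -> algC) :
  (forall i, Qadjoin A (F i)) -> Qadjoin A (\sum_(i <- r) F i).
Proof. by move=> AF; apply: big_ind => //; [apply: Qadjoin0 | apply: Qadjoin_add]. Qed.

Lemma Qadjoin_exp A x n : Qadjoin A x -> Qadjoin A (x ^+ n).
Proof.
move=> Ax; elim: n => [|n IHn]; first exact: Qadjoin_1.
by rewrite exprS; apply: Qadjoin_mul.
Qed.

Lemma Qadjoin_nat A n : Qadjoin A n%:R.
Proof.
elim: n => [|n IHn]; first exact: Qadjoin0.
by rewrite mulrS; apply: Qadjoin_add => //; apply: Qadjoin_1.
Qed.

Lemma Qadjoin_rat A (q : rat) : Qadjoin A (ratr q).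
Proof.
have Aint (m : int) : Qadjoin A m%:~R.
  case: m => m; first exact: Qadjoin_nat.
  by rewrite NegzE rmorphN /= -sub0r; apply: Qadjoin_sub;
    [apply: Qadjoin0 | apply: Qadjoin_nat].
by apply: Qadjoin_mul => //; apply: Qadjoin_inv.
Qed.

Lemma Qadjoin_trans A B x :
  (forall y, A y -> Qadjoin B y) -> Qadjoin A x -> Qadjoin B x.
Proof.
move=> sAB; elim=> {x} [x /sAB|||x y _ Bx _ By|x _ Bx] //; first exact: Qadjoin_1.
- by move=> x y _ Bx _ By; apply: Qadjoin_sub.
- exact: Qadjoin_mul.
exact: Qadjoin_inv.
Qed.

Lemma Qadjoin_eq_rmorph A (u v : {rmorphism algC -> algC}) x :
  (forall y, A y -> u y = v y) -> Qadjoin A x -> u x = v x.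
Proof.
move=> eq_uv; elim=> {x} [x /eq_uv|||x y _ eq_x _ eq_y|x _ eq_x] //.
- by rewrite !rmorph1.
- by move=> x y _ eq_x _ eq_y; rewrite !rmorphB /= eq_x eq_y.
- by rewrite !rmorphM /= eq_x eq_y.
by rewrite !fmorphV /= eq_x.
Qed.

Lemma Qelt_unity_root n w x : n.-primitive_root w -> x ^+ n = 1 -> Qelt w x.
Proof.
move=> pr_w /(prim_rootP pr_w)[i ->]; apply: Qadjoin_exp; exact: Qadjoin_gen.
Qed.

Lemma Qelt_char gT (G : {group gT}) (f : 'CF(G)) n w x :
    n.-primitive_root w -> f \is a character -> (#[x] %| n)%N ->
  Qelt w (f x).
Proof.
move=> pr_w Nf /dvdnP[m Dn].
have [Gx | /cfun0->] := boolP (x \in G); last exact: Qadjoin0.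
have [rG ->] := char_reprP Nf.
have [e [_ [en1 _] [-> _] _]] := repr_rsim_diag rG Gx.
apply: Qadjoin_sum => i; apply: Qelt_unity_root pr_w _.
by rewrite Dn mulnC exprM en1 expr1n.
Qed.

(** The Galois correspondence for the cyclotomic field of order [#|G|], whose
automorphisms all extend to [algC]. *)
Lemma Qelt_descent gT (G : {group gT}) w a b :
    #|G|.-primitive_root w -> Qelt w a -> Qelt w b ->
    (forall u : {rmorphism algC -> algC}, u a = a -> u b = b) ->
  Qelt a b.
Proof.
move=> pr_w Qa Qb fix_ab.
have [Qn galQn [QnC gQnC [w0 [pr_w0 _] _]]] := group_num_field_exists G.
have imQ x : Qelt w x -> exists x0, QnC x0 = x.
  elim=> {x} [x -> ||x y _ [x0 <-] _ [y0 <-]|x y _ [x0 <-] _ [y0 <-]|x _ [x0 <-]].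
  - rewrite -(fmorph_primitive_root QnC) in pr_w0.
    have [k ->] := prim_rootP pr_w0 (prim_expr_order pr_w).
    by exists (w0 ^+ k); rewrite rmorphXn.
  - by exists 1; rewrite rmorph1.
  - by exists (x0 - y0); rewrite rmorphB.
  - by exists (x0 * y0); rewrite rmorphM.
  by exists x0^-1; rewrite fmorphV.
have [[a0 Da] [b0 Db]] := (imQ a Qa, imQ b Qb).
have galQa : galois <<1; a0>> {:Qn}.
  by apply: galoisS galQn; rewrite subvf sub1v.
have : b0 \in <<1; a0>>%VS.
  rewrite -(galois_fixedField galQa); apply/fixedFieldP; first exact: memvf.
  move=> nu galnu; have [u Du] := gQnC nu; apply: (fmorph_inj QnC).
  rewrite Du Db fix_ab // -Da -Du; congr (QnC _).
  by rewrite (fixed_gal _ galnu) ?subvf ?memv_adjoin.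
move/Fadjoin_polyP => [p /polyOver1P[q ->] Db0].
rewrite -Db Db0 horner_coef rmorph_sum; apply: Qadjoin_sum => k.
rewrite rmorphM rmorphXn /= Da coef_map rmorphZ_num rmorph1 mulr1.
apply: Qadjoin_mul; first exact: Qadjoin_rat.
by apply: Qadjoin_exp; apply: Qadjoin_gen.
Qed.

Lemma cfDet_aut gT (G : {group gT}) (u : {rmorphism algC -> algC}) (f : 'CF(G)) :
  f \is a character -> cfDet (cfAut u f) = cfAut u (cfDet f).
Proof.
move=> /char_reprP[rG ->]; rewrite -cfRepr_map !cfDetRepr.
apply/cfun_inP=> x Gx; rewrite !cfunE Gx !mulr1n !trace_mx11 !mxE !mulr1n.
by rewrite map_reprE det_map_mx.
Qed.

Lemma pi_special_aut gT (G : {group gT}) pi (u : {rmorphism algC -> algC}) i :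
  pi_special pi i -> pi_special pi (@aut_Iirr _ G u i).
Proof.
case=> deg_i ord_i; split=> [|S nnSG j].
  by rewrite aut_IirrE cfAut_irr1.
have /codomP[k ->] : j \in codom (@aut_Iirr _ S u).
  exact: injF_onto (@aut_Iirr_inj _ S u) j.
rewrite aut_IirrE irr_consttE -cfAutRes aut_IirrE cfdot_aut_irr fmorph_eq0.
move=> Sk; rewrite /cfDet_order cfDet_aut ?irr_char //.
rewrite cforder_inj_rmorph; last exact: cfAut_inj.
exact: (ord_i S nnSG).
Qed.

(** The conjugate of ['chi_i] by [u] is [p]-special and has the same
restriction to a Sylow [p]-subgroup, so it is ['chi_i] by
[cfdot_Res_Sylow]. *)
Lemma p_special_aut_fixed gT (G : {group gT}) (p : nat) i w
    (u : {rmorphism algC -> algC}) :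
    solvable G -> pi_special p i -> (#|G|`_p).-primitive_root w -> u w = w ->
  cfAut u 'chi[G]_i = 'chi_i.
Proof.
move=> solG p_i pr_w uw; have [P sylP] := Sylow_exists p G.
have uP : 'Res[P] (cfAut u 'chi_i) = 'Res[P] 'chi_i.
  apply/cfun_inP=> x Px; rewrite !cfResE ?(pHall_sub sylP) // cfunE /=.
  apply: (@Qadjoin_eq_rmorph (fun x => x = w) u idfun) => [_ ->|] //.
  apply: Qelt_char pr_w (irr_char i) _.
  by rewrite -(card_Hall sylP) order_dvdG.
apply/esym/eqP; rewrite -aut_IirrE; apply/eqP.
have := cfdot_Res_Sylow solG sylP (pi_special_span p_i)
          (pi_special_span (pi_special_aut u p_i)).
rewrite aut_IirrE uP (cfdot_Res_Sylow solG sylP) -?aut_IirrE;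
  try exact: pi_special_span.
rewrite cfnorm_irr cfdot_irr; case: eqP => [<- //|_ /eqP].
by rewrite oner_eq0.
Qed.

Lemma p_special_Qelt gT (G : {group gT}) (p : nat) i w x :
    solvable G -> pi_special p i -> (#|G|`_p).-primitive_root w ->
  Qelt w ('chi[G]_i x).
Proof.
move=> solG p_i pr_w; have [Gx | /cfun0->] := boolP (x \in G); last exact: Qadjoin0.
have [z pr_z] := C_prim_root_exists (cardG_gt0 G).
apply: (Qelt_descent pr_z).
- apply: Qelt_unity_root pr_z _; have [m ->] := dvdnP (dvdn_part p #|G|).
  by rewrite mulnC exprM (prim_expr_order pr_w) expr1n.
- by apply: Qelt_char pr_z (irr_char i) _; apply: order_dvdG.
move=> u uw; rewrite -[in RHS](p_special_aut_fixed solG p_i pr_w uw).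
by rewrite cfunE.
Qed.

(** * Nonvanishing on cosets *)

(** Up to a scalar, the sum is the trace of [g] times the projection onto the
[lam]-isotypic part of the restriction to [Y], which vanishes. Here this is
shown by computing the square norm of the sum as a function of [g]. *)
Lemma sum_translate_lin gT (G Y : {group gT}) i (lam : 'CF(Y)) g :
    Y \subset G -> lam \is a linear_char -> '['Res[Y] 'chi[G]_i, lam] = 0 ->
    g \in G ->
  \sum_(y in Y) 'chi_i (g * y)%g * (lam y)^* = 0.
Proof.
move=> sYG lin_lam orth.
pose F x := \sum_(y in Y) 'chi_i (x * y)%g * (lam y)^*.
have sumF0 : \sum_(x in G) F x * (F x)^* = 0.
  transitivity (\sum_(y' in Y) \sum_(y in Y) (lam y)^* * lam y' *
                 \sum_(x in G) 'chi_i (x * y)%g * ('chi_i (x * y')%g)^*).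
    transitivity (\sum_(x in G) \sum_(y' in Y) \sum_(y in Y) (lam y)^* * lam y'
                   * ('chi_i (x * y)%g * ('chi_i (x * y')%g)^*)).
      apply: eq_bigr => x _; rewrite rmorph_sum mulr_sumr; apply: eq_bigr => y' _.
      rewrite mulr_suml; apply: eq_bigr => y _; rewrite rmorphM /= conjCK.
      by rewrite mulrACA mulrC.
    rewrite exchange_big; apply: eq_bigr => y' _; rewrite exchange_big.
    by apply: eq_bigr => y _; rewrite mulr_sumr.
  apply: big1 => y' Yy'; have Gy' := subsetP sYG y' Yy'.
  pose c := #|G|%:R / 'chi[G]_i 1%g.
  transitivity (\sum_(y in Y) (lam y)^* * (c * 'chi_i y)); last first.
    move/eqP: orth; rewrite cfdotE mulf_eq0 invr_eq0 (negPf (neq0CG Y)) /=.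
    move=> /eqP orth.
    rewrite -[RHS](mulr0 c) -[in RHS]orth mulr_sumr; apply: eq_bigr => y Yy.
    by rewrite cfResE // mulrC mulrA.
  rewrite (reindex_inj (mulgI y')) /=; apply: eq_big => [y | y].
    by rewrite groupMl.
  rewrite groupMl // => Yy; congr (_ * _).
    rewrite lin_charM // rmorphM /= mulrAC -normCKC normC_lin_char //.
    by rewrite expr1n mul1r.
  transitivity (\sum_(x in G) 'chi_i (x * y)%g * 'chi_i x^-1%g).
    rewrite (reindex_inj (mulIg y'^-1%g)) /=; apply: eq_big => [x|x _].
      by rewrite groupMr ?groupV.
    by rewrite mulgA mulgKV irr_inv.
  have := generalized_orthogonality_relation y i i; rewrite eqxx mul1r => genE.
  by rewrite /c [RHS]mulrAC -[RHS]mulrA -genE mulVKf ?neq0CG.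
have F0 x : x \in G -> F x = 0.
  move=> Gx; apply/eqP; rewrite -normr_eq0 -sqrf_eq0 normCK; apply/eqP.
  by apply: (psumr_eq0P _ sumF0) => // y _; apply: mul_conjC_ge0.
exact: F0.
Qed.

(** Fourier inversion on the abelian group [N / D]: only the trivial character
contributes to the sums over cosets. *)
Lemma sum_coset_quo gT (N D : {group gT}) (h : gT -> algC) z :
    D <| N -> abelian (N / D) -> z \in N ->
    (forall l : Iirr (N / D), l != 0 ->
       \sum_(y in N) h y * (('chi_l %% D)%CF y)^* = 0) ->
  #|N : D|%:R * (\sum_(y in N | coset D y == coset D z) h y)
    = \sum_(y in N) h y.
Proof.
move=> nsDN abND Nz orth.
have Nzb : coset D z \in (N / D)%g by rewrite mem_quotient.
transitivity (\sum_(l : Iirr (N / D)) 'chi_l (coset D z) *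
                 (\sum_(y in N) h y * (('chi_l %% D)%CF y)^*)); last first.
  rewrite (bigD1 0) //= [X in _ + X]big1 ?addr0; last first.
    by move=> l nz_l; rewrite orth ?mulr0.
  rewrite irr0 cfun1E Nzb mul1r; apply: eq_bigr => y Ny.
  by rewrite cfMod_cfun1 cfun1E Ny conjC1 mulr1.
transitivity (\sum_(y in N) h y *
    \sum_(l : Iirr (N / D)) 'chi_l (coset D z) * ('chi_l (coset D y))^*).
  rewrite mulr_sumr big_mkcondr /=; apply: eq_bigr => y Ny.
  have Nyb : coset D y \in (N / D)%g by rewrite mem_quotient.
  rewrite second_orthogonality_relation //.
  rewrite (abelian_classP _ abND) // inE eq_sym; case: eqP => _; last by rewrite mulr0.
  have -> : 'C_(N / D)[coset D z]%g = (N / D)%g.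
    by apply/setIidPl; rewrite sub_cent1 (subsetP abND).
  by rewrite mulrC mulr1n card_quotient ?normal_norm.
under eq_bigr do rewrite mulr_sumr.
rewrite exchange_big; apply: eq_bigr => l _; rewrite mulr_sumr.
by apply: eq_bigr => y Ny; rewrite cfModE // mulrCA.
Qed.

(** Let [h] be the function [|f (g * y)| ^+ 2] of [y]. A nontrivial linear
character [lam] of [N / D] is [pi^']-special, so
['['Res 'chi_i, lam * 'Res 'chi_j] = 0] for all [pi]-special [i] and [j] by
[cfdot_special_prod]. Hence [h] is orthogonal to [lam], and its sums over [D]
and over [z *: D] agree. The first one is positive. *)
Lemma special_span_coset_neq0 gT (G N D : {group gT}) pi (f : 'CF(G)) g z :
    solvable G -> N <| G -> D <| N -> abelian (N / D) -> pi^'.-group (N / D) ->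
    special_span pi f -> g \in G -> z \in N -> f g != 0 ->
  exists2 y, y \in (z *: D)%g & f (g * y)%g != 0.
Proof.
move=> solG nsNG nsDN abND pi'ND f_pi Gg Nz nz_fg.
have sNG := normal_sub nsNG; have solN := solvableS sNG solG.
pose h y := f (g * y)%g * (f (g * y)%g)^*.
have h_ge0 y : 0 <= h y by apply: mul_conjC_ge0.
have orth (l : Iirr (N / D)) : l != 0 ->
   \sum_(y in N) h y * (('chi_l %% D)%CF y)^* = 0.
- move=> nz_l; set lam := ('chi_l %% D)%CF.
  have lin_l : 'chi_l \is a linear_char by apply/char_abelianP.
  have lin_lam : lam \is a linear_char by apply: cfMod_lin_char.
  have pi'lam : pi^'.-nat #[lam]%CF.
    apply: pnat_dvd pi'ND; rewrite cforder_mod //.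
    exact: cforder_lin_char_dvdG.
  have /irrP[m Dm] := lin_char_irr lin_lam.
  have pi'm : pi_special pi^' m by apply: pi_special_lin; rewrite -Dm.
  have pi'1 : pi_special pi^' (0 : Iirr N) by apply: pi_special0.
  have nz_m : 0 != m.
    apply: contraNneq nz_l => m0; rewrite -irr_eq1 -(cfMod_eq1 _ nsDN).
    by rewrite -/lam Dm -m0 irr0.
  have dis : {in pi, forall p, p \notin pi^'} by move=> p; rewrite inE negbK.
  pose term i j y := 'chi[G]_i (g * y)%g * ('chi[G]_j (g * y)%g)^*.
  have irr_case i j : pi_special pi i -> pi_special pi j ->
    \sum_(y in N) term i j y * (lam y)^* = 0.
  - move=> pi_i pi_j; pose theta := 'chi_i * ('chi_j)^*%CF.
    have Ntheta : theta \is a character by rewrite rpredM ?cfConjC_char ?irr_char.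
    have orth_theta : '['Res[N] theta, lam] = 0.
      have: '['Res[N] 'chi_i * 'chi_0, 'Res[N] 'chi_j * 'chi_m] = 0.
        rewrite (cfdot_special_prod solN dis);
          try (apply: special_span_Res_normal => //); try exact: pi_special_span.
        by rewrite cfdot_irr (negPf nz_m) mulr0.
      rewrite irr0 mulr1 -Dm => <-; rewrite !cfdotE; congr (_ * _).
      apply: eq_bigr => y Ny; rewrite !cfResE // !cfunE cfResE // rmorphM /=.
      by rewrite mulrA.
    transitivity (\sum_(y in N) theta (g * y)%g * (lam y)^*).
      by apply: eq_bigr => y _; rewrite !cfunE.
    rewrite [theta]cfun_sum_constt.
    transitivity (\sum_(k in irr_constt theta) '[theta, 'chi_k] *
        \sum_(y in N) 'chi_k (g * y)%g * (lam y)^*).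
      under eq_bigr do rewrite sum_cfunE mulr_suml.
      rewrite exchange_big /=; apply: eq_bigr => k _; rewrite mulr_sumr.
      by apply: eq_bigr => y _; rewrite cfunE mulrA.
    rewrite big1 // => k theta_k; rewrite sum_translate_lin ?mulr0 //.
    apply/eqP; apply: contraT; rewrite Dm => k_m.
    have := constt_Res_trans Ntheta theta_k k_m.
    by rewrite irr_consttE -Dm orth_theta eqxx.
  transitivity (\sum_(i in irr_constt f) \sum_(j in irr_constt f)
      '[f, 'chi_i] * ('[f, 'chi_j])^* * \sum_(y in N) term i j y * (lam y)^*).
    under [RHS]eq_bigr do (under eq_bigr do rewrite mulr_sumr).
    under [RHS]eq_bigr do rewrite exchange_big.
    rewrite [RHS]exchange_big; apply: eq_bigr => y _.
    rewrite /h {1 2}[f]cfun_sum_constt !sum_cfunE rmorph_sum !mulr_suml.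
    apply: eq_bigr => i _; rewrite mulr_sumr mulr_suml; apply: eq_bigr => j _.
    rewrite !cfunE rmorphM /= /term [RHS]mulrA; congr (_ * _).
    exact: mulrACA.
  rewrite big1 // => i /f_pi pi_i; rewrite big1 // => j /f_pi pi_j.
  by rewrite irr_case ?mulr0.
have sum1 := sum_coset_quo nsDN abND (group1 N) orth.
have := sum_coset_quo nsDN abND Nz orth; rewrite -{}sum1.
move/(mulfI _); rewrite pnatr_eq0 -lt0n indexg_gt0 => /(_ isT) sum_z.
have: \sum_(y in N | coset D y == coset D z) h y != 0.
  rewrite sum_z gt_eqF // (bigD1 1%g) ?group1 //= ltr_wpDr ?sumr_ge0 //.
  by rewrite /h mulg1 mul_conjC_gt0.
move=> nz_sum; have /existsP[y /and3P[Ny zy nz_hy]] :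
    [exists y, [&& y \in N, coset D y == coset D z & h y != 0]].
  apply: contraR nz_sum => /existsPn hy0; apply/eqP/big1 => y /andP[Ny zy].
  by have := hy0 y; rewrite Ny zy /= negbK => /eqP.
have nDN := subsetP (normal_norm nsDN).
exists y; last by apply: contraNneq nz_hy; rewrite /h => ->; rewrite mul0r.
rewrite -norm_rlcoset ?nDN //.
by apply/rcoset_kercosetP; rewrite ?nDN //; apply/eqP.
Qed.

(** * A section on which only one factor acts *)

Lemma cfcenter_mul gT (G : {group gT}) i z :
    z \in ('Z('chi[G]_i))%CF ->
  exists c, forall g, 'chi_i (g * z)%g = c * 'chi_i g.
Proof.
rewrite -irrRepr cfcenter_repr => /setIdP[Gz /is_scalar_mxP[c Dz]].
exists c => g; rewrite !cfunE groupMr //; case: (boolP (g \in G)) => [Gg | _].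
  by rewrite repr_mxM // Dz mul_mx_scalar mxtraceZ !mulr1n.
by rewrite !mulr0n mulr0.
Qed.

Lemma prime_primitive_root p (c : algC) :
  prime p -> c ^+ p = 1 -> c != 1 -> p.-primitive_root c.
Proof.
move=> pr_p cp1 nz_c; have [m pr_m] := prim_order_exists (prime_gt0 pr_p) cp1.
move/eqP: cp1; rewrite -(prim_order_dvd pr_m) => m_p.
case/primeP: pr_p => _ /(_ m m_p).
case/orP=> /eqP Dm; last by rewrite -Dm.
by case/eqP: nz_c; rewrite -[c]expr1 -Dm prim_expr_order.
Qed.

Lemma irr_ker_full gT (G : {group gT}) (i : Iirr G) : G \subset cfker 'chi_i -> i = 0.
Proof.
move=> kerG; have := cfRes_sub_ker kerG; rewrite cfRes_id => Di.
have : '['chi_i, 'chi_0] != 0.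
  by rewrite Di irr0 cfdotZl cfnorm1 mulr1 irr1_neq0.
by rewrite cfdot_irr pnatr_eq0 eqb0 negbK => /eqP.
Qed.

(** [D] is the common kernel and [N / D] a minimal normal subgroup of [G / D],
a [p]-group. For [q != p], the constituents of the restriction of [psi q] to
[N] are linear of order both a power of [p] and a power of [q], so [N] lies in
the kernel. Hence [p] belongs to [R]. The element [z] of a Sylow [p]-subgroup
[P] represents a nontrivial element of [N / D] central in [P / D]; it acts as a
scalar for [psi p] because [psi p] is irreducible on [P]. *)
Lemma special_central_section gT (G : {group gT}) (R : seq nat) (psi : nat -> Iirr G) :
    solvable G -> R != [::] ->
    {in R, forall q, [/\ prime q, pi_special q (psi q) & psi q != 0]} ->
  exists p, exists D : {group gT}, exists N : {group gT}, exists z, exists zeta,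
    [/\ [/\ p \in R, N <| G, D <| N, abelian (N / D) & p.-group (N / D)],
        {in R, forall q, q != p -> N \subset cfker 'chi_(psi q)},
        D \subset cfker 'chi_(psi p), z \in N &
        p.-primitive_root zeta
         /\ forall g, 'chi_(psi p) (g * z)%g = zeta * 'chi_(psi p) g].
Proof.
move=> solG ntR specR; pose theta := \sum_(q <- R) 'chi_(psi q).
have Ntheta : theta \is a character by apply: rpred_sum => q _; apply: irr_char.
pose D := [group of cfker theta].
have nsDG : D <| G by apply: cfker_normal.
have sDK q : q \in R -> D \subset cfker 'chi_(psi q).
  move=> Rq; apply: cfker_constt => //; rewrite irr_consttE cfdot_suml.
  rewrite (big_rem q) //= cfnorm_irr gt_eqF // ltr_pwDl ?ltr01 // sumr_ge0 //.
  by move=> i _; rewrite cfdot_irr ler0n.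
have capD x : x \in G -> {in R, forall q, x \in cfker 'chi_(psi q)} -> x \in D.
  move=> Gx Kx; rewrite -[x \in D]/(x \in cfker theta) cfkerEchar // inE Gx !sum_cfunE.
  by apply/eqP; rewrite !big_seq; apply: eq_bigr => q /Kx/cfker1.
have ntGD : (G / D)%g != 1%g.
  case: R ntR specR @theta Ntheta @D nsDG sDK capD => // q R _ specR theta _ D nsDG sDK _.
  have [_ _ nz_q] := specR q (mem_head q R).
  apply: contra nz_q => /eqP/trivgP; rewrite quotient_sub1 ?normal_norm // => sGD.
  by apply/eqP/irr_ker_full; apply: subset_trans sGD (sDK q (mem_head q R)).
(* [N] is obtained as the preimage of a minimal normal subgroup [Nb] of [G / D]. *)
have [Nb minNb sNb] : {Nb : {group coset_of D} | minnormal Nb (G / D) & Nb \subset (G / D)%g}.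
  by apply: minnormal_exists; rewrite ?normG.
have [nNGb ntNb /is_abelemP[p pr_p abelNb]] :=
  minnormal_solvable minNb sNb (quotient_sol D solG).
have nsNb : Nb <| (G / D)%g by rewrite /normal sNb.
have [N defN sDN nsNG] := inv_quotientN nsDG nsNb.
have sNG := normal_sub nsNG; have nsDN := normalS sDN sNG nsDG.
have [pN abN] : p.-group (N / D) /\ abelian (N / D).
  by rewrite -defN (abelem_pgroup abelNb) (abelem_abelian abelNb).
have nDN := subsetP (normal_norm nsDN).
have expN x : x \in N -> (x ^+ p)%g \in D.
  move=> Nx; apply: coset_idr; first by rewrite groupX ?nDN.
  rewrite morphX ?nDN //; have /abelemP[//|_ -> //] := abelNb.
  by rewrite defN mem_quotient.
have kerN : {in R, forall q, q != p -> N \subset cfker 'chi_(psi q)}.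
  move=> q Rq neq_qp; have [pr_q spec_q _] := specR q Rq.
  have [j Nj] := constt_cfRes_irr N (psi q).
  have sDj : D \subset cfker 'chi_j.
    apply: subset_trans (cfker_constt (cfRes_char N (irr_char (psi q))) Nj).
    by rewrite cfker_Res ?irr_char // subsetI sDN sDK.
  have lin_j : 'chi_j \is a linear_char.
    by rewrite lin_irr_der1 (subset_trans _ sDj) // der1_min ?normal_norm.
  have p_j : (#['chi_j]%CF %| p)%N.
    apply/dvdn_cforderP => x Nx; rewrite -lin_charX // cfker1 ?lin_char1 //.
    by rewrite (subsetP sDj) ?expN.
  have q_j : (q : nat_pred).-nat #['chi_j]%CF.
    by rewrite -cfDet_order_lin //; have [_] := spec_q;
       apply; first exact: normal_subnormal.
  have j1 : j = 0.
    apply/eqP; rewrite -irr_eq1 -['chi_j]expr1 -dvdn_cforder dvdn1.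
    have /primeP[_ /(_ _ p_j)/orP[-> // | /eqP Dj]] := pr_p.
    by rewrite Dj pnatE // inE eq_sym (negPf neq_qp) in q_j.
  by rewrite constt0_Res_cfker // -j1.
have Rp : p \in R.
  apply: contraR ntNb => R'p; rewrite defN; apply/eqP/trivgP.
  rewrite quotient_sub1 ?normal_norm //; apply/subsetP=> x Nx.
  apply: capD => [|q Rq]; first exact: (subsetP sNG).
  by apply: (subsetP (kerN q Rq _)) => //; apply: contraNneq R'p => <-.
have [P sylP] := Sylow_exists p G; have [sPG pP _] := and3P sylP.
have sNPb : Nb \subset (P / D)%g.
  apply: subset_trans (pcore_sub_Hall (quotient_pHall _ sylP)).
    by rewrite pcore_max // (abelem_pgroup abelNb).
  by rewrite (subset_trans sPG) ?normal_norm.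
have nilPb : nilpotent (P / D) by rewrite (pgroup_nil (quotient_pgroup D pP)).
have nsNPb : Nb <| (P / D)%g.
  by rewrite /normal sNPb (subset_trans (quotientS D sPG) (normal_norm nsNb)).
have /trivgPn[zb /setIP[Nzb /setIP[Pzb cPzb]] ntzb] := meet_center_nil nilPb nsNPb ntNb.
have [z nDz Pz Dzb] := morphimP Pzb.
have Nz : z \in N.
  move: Nzb; rewrite defN Dzb => /morphimP[x nDx Nx /rcoset_kercosetP].
  by move=> /(_ nDz nDx)/rcosetP[d Dd ->]; rewrite groupM // (subsetP sDN).
have [pr_p' spec_p nz_p] := specR p Rp.
have D'z : z \notin D by apply: contraNN ntzb => Dz; rewrite Dzb /= coset_id.
have irr_P : 'Res[P] 'chi_(psi p) \in irr P.
  rewrite irrEchar cfRes_char ?irr_char //=.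
  by rewrite (cfdot_Res_Sylow solG sylP) ?cfnorm_irr //; apply: pi_special_span.
have [eta Deta] := irrP irr_P.
have Zz : z \in ('Z('chi_eta))%CF.
  set K := cfker 'chi_eta; have nKP := subsetP (cfker_norm 'chi_eta).
  have nDP x : x \in P -> x \in 'N(D).
    by move=> Px; rewrite (subsetP (normal_norm nsDG)) ?(subsetP sPG).
  have : coset K z \in ('Z('chi_eta)%CF / K)%g.
    rewrite cfcenter_eq_center; apply/centerP; rewrite mem_quotient //.
    split=> // _ /morphimP[x nKx Px ->]; apply/commgP.
    rewrite -morphR ?nKP //= coset_id // /K -Deta cfker_Res ?irr_char //.
    rewrite inE groupR //= (subsetP (sDK p Rp)) //.
    apply: coset_idr; first by rewrite groupR ?nDP.
    rewrite morphR ?nDP //; apply/eqP/commgP; rewrite -[coset_morphism D z]Dzb.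
    by apply: (centP cPzb); rewrite mem_quotient.
  case/morphimP=> y nKy Zy /rcoset_kercosetP.
  move=> /(_ (nKP z Pz) nKy)/rcosetP[k Kk ->]; rewrite groupM //.
  exact: (subsetP (normal_sub (cfker_center_normal 'chi_eta))).
have Gz := subsetP sPG z Pz.
have {}Zz : z \in ('Z('chi_(psi p)))%CF.
  move: Zz; rewrite !irr_cfcenterE // -Deta.
  by rewrite !cfResE.
have [zeta Dzeta] := cfcenter_mul Zz.
exists p, D, N, z, zeta; split=> //; first exact: sDK.
split=> //; apply: prime_primitive_root => //.
  have nz1 := irr1_neq0 (psi p).
  have zpow k : 'chi_(psi p) (z ^+ k)%g = zeta ^+ k * 'chi_(psi p) 1%g.
    elim: k => [|k IHk]; first by rewrite mul1r.
    by rewrite expgSr Dzeta IHk mulrA exprS.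
  have := zpow p; rewrite cfker1; last by rewrite (subsetP (sDK p Rp)) ?expN.
  by rewrite -[LHS]mul1r => /(mulIf nz1).
apply: contraNneq D'z => z1; apply: capD => // q Rq.
have [-> | neq_qp] := eqVneq q p; last by rewrite (subsetP (kerN q Rq neq_qp)).
by rewrite cfkerEirr inE -[z]mul1g Dzeta z1 mul1r.
Qed.

(** * Powers congruent to 1 modulo an odd prime *)

(** In the binomial expansion all terms after the first two are divisible by
[p ^ i.+2]. For the last one this uses [2 < p]. *)
Lemma pow_one_plus_p p i c :
    prime p -> odd p -> (0 < i)%N -> ~~ (p %| c)%N ->
  exists2 c', ~~ (p %| c')%N & ((1 + p ^ i * c) ^ p = 1 + p ^ i.+1 * c')%N.
Proof.
move=> pr_p odd_p i_gt0 p'c; have p_gt2 := odd_prime_gt2 odd_p pr_p.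
set x := (p ^ i * c)%N.
have [s Ds] : exists s, ((1 + x) ^ p = 1 + p * x + p ^ i.+2 * s)%N.
  have : (p ^ i.+2 %| \sum_(2 <= j < p.+1) 'C(p, j) * (1 ^ (p - j) * x ^ j))%N.
    rewrite big_nat; apply: dvdn_sum => j /andP[j_gt1 le_jp].
    rewrite exp1n mul1n /x expnMn -expnM mulnA; apply: dvdn_mulr.
    have [lt_jp | le_pj] := ltnP j p.
      rewrite expnS dvdn_mul ?prime_dvd_bin ?lt_jp ?(ltnW j_gt1) //.
      apply: dvdn_exp2l; rewrite -[i.+1]addn1.
      by rewrite (@leq_trans (i * 2)) // ?leq_mul2l ?j_gt1 ?orbT // muln2 -addnn leq_add2l.
    apply: dvdn_mull; apply: dvdn_exp2l.
    rewrite (@leq_trans (i * 3)) //; last first.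
      by rewrite leq_mul2l (leq_trans p_gt2) ?orbT.
    by rewrite mulnS -addn2 leq_add2l (leq_trans _ (leq_pmull _ i_gt0)).
  case/dvdnP=> s Ds; exists s; rewrite expnDn -(big_mkord xpredT
     (fun j => 'C(p, j) * (1 ^ (p - j) * x ^ j))%N) big_ltn // big_ltn ?Ds; last first.
    by rewrite ltnS prime_gt0.
  by rewrite bin0 bin1 !exp1n !mul1n expn0 expn1 addnA [(s * _)%N]mulnC.
exists (c + p * s)%N; first by rewrite dvdn_addl ?dvdn_mulr.
by rewrite Ds /x mulnA -expnS -addnA [(p ^ i.+2)%N]expnSr -[(_ * p * s)%N]mulnA -mulnDr.
Qed.

Lemma pow_one_plus_p_iter p i c j :
    prime p -> odd p -> (0 < i)%N -> ~~ (p %| c)%N ->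
  exists2 c', ~~ (p %| c')%N & ((1 + p ^ i * c) ^ (p ^ j) = 1 + p ^ (i + j) * c')%N.
Proof.
move=> pr_p odd_p i_gt0 p'c; elim: j => [|j [c1 p'c1 Dc1]].
  by exists c; rewrite // addn0 expn1.
have [|c2 p'c2 Dc2] := pow_one_plus_p pr_p odd_p _ p'c1 (i := (i + j)%N).
  by rewrite addn_gt0 i_gt0.
by exists c2; rewrite // expnSr expnM Dc1 Dc2 addnS.
Qed.

Lemma exp_one_plus_mod b x t p :
  (0 < b)%N -> (1 + p ^ b * x) ^ t = 1 + p ^ b * (x * t) %[mod p ^ b.+1].
Proof.
move=> b_gt0; elim: t => [|t IHt]; first by rewrite !muln0.
rewrite expnS -modnMmr IHt modnMmr.
have -> : ((1 + p ^ b * x) * (1 + p ^ b * (x * t))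
   = 1 + p ^ b * (x * t.+1) + p ^ b * p ^ b * (x * x * t))%N.
  by ring.
apply/eqP; rewrite -{2}[(1 + _)%N]addn0 eqn_modDl -expnD mod0n.
by apply/dvdn_mulr/dvdn_exp2l; rewrite -addn1 leq_add2l.
Qed.

(** For odd [p], the group of [p]-adic units congruent to 1 modulo [p ^ i] is
topologically generated by each of its elements that is not congruent to 1
modulo [p ^ i.+1]. *)
Lemma exp_approx p i c l b :
    prime p -> odd p -> (0 < i)%N -> ~~ (p %| c)%N -> l = 1 %[mod p ^ i] ->
  exists e, (1 + p ^ i * c) ^ e = l %[mod p ^ b].
Proof.
move=> pr_p odd_p i_gt0 p'c Dl; set k := (1 + p ^ i * c)%N.
elim: b => [|b [e De]]; first by exists 0; rewrite expn0 !modn1.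
have [lt_bi | le_ib] := ltnP b i.
  exists 0; rewrite expn0; apply/eqP; rewrite eq_sym.
  apply/eqP/esym; rewrite -(modn_dvdm l (dvdn_exp2l p lt_bi)) Dl.
  by rewrite modn_dvdm ?dvdn_exp2l.
have [c' p'c' Dc'] := pow_one_plus_p_iter (b - i) pr_p odd_p i_gt0 p'c.
rewrite subnKC // -/k in Dc'; have b_gt0 := leq_trans i_gt0 le_ib.
(* [l'] is congruent to [l] and large enough to subtract [k ^ e] from it. *)
pose l' := (l + p ^ b.+1 * k ^ e)%N.
have le_kl : (k ^ e <= l')%N.
  by rewrite /l' (leq_trans _ (leq_addl _ _)) // leq_pmull // expn_gt0 prime_gt0.
have [d Dd] : exists d, l' = (k ^ e + p ^ b * d)%N.
  have : (p ^ b %| l' - k ^ e)%N.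
    rewrite -eqn_mod_dvd //; apply/eqP.
    have -> : l' = (p * k ^ e * p ^ b + l)%N by rewrite /l' expnS; ring.
    by rewrite modnMDl De.
  by case/dvdnP=> d Dd; exists d; rewrite mulnC -Dd subnKC.
have k1 : k ^ e = 1 %[mod p].
  rewrite -modnXm /k -(prednK i_gt0) expnS -mulnA addnC mulnC modnMDl.
  by rewrite modnXm exp1n.
(* [t] solves [c' * t = d] modulo [p]. *)
pose t := (d * c' ^ (totient p).-1)%N.
have Dt : k ^ e * (c' * t) = d %[mod p].
  rewrite -modnMml k1 modnMml mul1n /t mulnCA -expnS prednK ?totient_gt0 ?prime_gt0 //.
  by rewrite -modnMmr Euler_exp_totient ?modnMmr ?muln1 // coprime_sym prime_coprime.
exists (e + p ^ (b - i) * t)%N.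
rewrite expnD expnM Dc' -modnMmr exp_one_plus_mod // modnMmr.
have -> : l = l' %[mod p ^ b.+1] by rewrite /l' addnC mulnC modnMDl.
rewrite Dd mulnDr muln1 mulnCA; apply/eqP; rewrite eqn_modDl expnSr.
by rewrite -!muln_modr Dt.
Qed.

(** * Automorphisms and roots of unity *)

Section RootsOfUnity.

Implicit Types u v s : {rmorphism algC -> algC}.

Definition fixes_roots n v := forall z : algC, z ^+ n = 1 -> v z = z.

(** For an algebraic number, being fixed by all automorphisms amounts to being
rational. *)
Definition rational_number (r : algC) := forall v, v r = r.

Lemma aut_exponent n v :
  (0 < n)%N -> exists2 k, coprime k n & forall z, z ^+ n = 1 -> v z = z ^+ k.
Proof.
move=> n_gt0; have [w pr_w] := C_prim_root_exists n_gt0.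
have [k co_kn Dw] := aut_prim_rootP v pr_w; exists k => // z.
by case/(prim_rootP pr_w)=> i ->; rewrite rmorphXn /= Dw exprAC.
Qed.

Lemma aut_iter v e : exists w : {rmorphism algC -> algC}, forall x, w x = iter e v x.
Proof.
elim: e => [|e [w Dw]]; first by exists idfun.
by exists (v \o w) => x; rewrite /= Dw.
Qed.

Lemma iter_fix (T : Type) (f : T -> T) e x : f x = x -> iter e f x = x.
Proof. by move=> fx; elim: e => //= e ->. Qed.

Lemma iter_exponent v n k e z :
  (forall z, z ^+ n = 1 -> v z = z ^+ k) -> z ^+ n = 1 -> iter e v z = z ^+ (k ^ e).
Proof.
move=> Dv zn1; elim: e => [|e IHe]; first by rewrite expn0 expr1.
by rewrite iterS IHe rmorphXn /= Dv // -exprM expnS.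
Qed.

Lemma fixes_roots_exponent n m k v :
    (0 < n)%N -> (m %| n)%N -> (forall z, z ^+ n = 1 -> v z = z ^+ k) ->
  fixes_roots m v <-> k = 1 %[mod m].
Proof.
move=> n_gt0 m_n Dv; have m_gt0 := dvdn_gt0 n_gt0 m_n.
have rootn z : z ^+ m = 1 -> z ^+ n = 1.
  by case/dvdnP: m_n => q ->; rewrite mulnC exprM => ->; rewrite expr1n.
split=> [fix_v | Dk z zm1].
  have [w pr_w] := C_prim_root_exists m_gt0; have wm1 := prim_expr_order pr_w.
  apply/eqP; rewrite -(eq_prim_root_expr pr_w) -Dv ?rootn // expr1.
  by rewrite fix_v.
by rewrite Dv ?rootn // -(expr_mod _ zm1) Dk (expr_mod _ zm1) expr1.
Qed.

(** The Chinese remainder theorem for the exponents by which automorphisms act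
on the [n]-th roots of unity. *)
Lemma aut_pi_part n p v : (0 < n)%N ->
  exists t : {rmorphism algC -> algC},
    (forall z, z ^+ n`_p = 1 -> t z = v z) /\ fixes_roots n`_p^' t.
Proof.
move=> n_gt0; have [k co_kn Dv] := aut_exponent v n_gt0.
have co_pp' : coprime n`_p n`_p^' by apply: coprime_partC.
pose m := chinese n`_p n`_p^' k 1.
have [m_p m_p'] : m = k %[mod n`_p] /\ m = 1 %[mod n`_p^'].
  by split; [apply: chinese_modl | apply: chinese_modr].
have co_mn : coprime m n.
  have co1 : coprime m n`_p.
    by rewrite -coprime_modl m_p coprime_modl (coprime_dvdr (dvdn_part p n)).
  have co2 : coprime m n`_p^' by rewrite -coprime_modl m_p' coprime_modl coprime1n.
  by rewrite -(partnC p n_gt0) coprimeMr co1.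
have [t Dt] := Qn_aut_exists co_mn; exists t.
have rootn q (z : algC) : z ^+ n`_q = 1 -> z ^+ n = 1.
  by case/dvdnP: (dvdn_part q n) => d {2}->; rewrite mulnC exprM => ->; rewrite expr1n.
split=> z z1; last first.
  by rewrite Dt ?(rootn _ _ z1) // -(expr_mod m z1) m_p' (expr_mod 1 z1) expr1.
by rewrite Dt ?Dv ?(rootn _ _ z1) // -(expr_mod m z1) m_p (expr_mod k z1).
Qed.

(** [w] is a power of [v]. On roots of unity of [p]-power order, [v] and [s]
act by exponents [k] and [l], where [k] is first different from 1 modulo a power
of [p] that is at most [p ^ m.+1], while [l] is 1 modulo [p ^ m]; so
[exp_approx] applies. *)
Lemma aut_power_approx p b m v s :
    prime p -> odd p -> fixes_roots p v -> ~ fixes_roots (p ^ m.+1) v ->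
    fixes_roots (p ^ m) s ->
  exists w : {rmorphism algC -> algC}, (forall x, v x = x -> w x = x)
    /\ (forall z, z ^+ (p ^ b) = 1 -> w z = s z).
Proof.
move=> pr_p odd_p fix_v nfix_v fix_s; set B := (b + m.+1)%N.
have pB_gt0 : (0 < p ^ B)%N by rewrite expn_gt0 prime_gt0.
have dvdB c : (c <= B)%N -> (p ^ c %| p ^ B)%N by apply: dvdn_exp2l.
have [k co_k Dv] := aut_exponent v pB_gt0.
have [l _ Ds] := aut_exponent s pB_gt0.
have leB : (m.+1 <= B)%N by rewrite leq_addl.
have k1 : k = 1 %[mod p].
  by apply/(fixes_roots_exponent pB_gt0 _ Dv); rewrite // -{1}[p]expn1 dvdB //
     (leq_trans _ leB).
have nk1 : k <> 1 %[mod p ^ m.+1].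
  by move/(fixes_roots_exponent pB_gt0 (dvdB _ leB) Dv).
have l1 : l = 1 %[mod p ^ m].
  by apply/(fixes_roots_exponent pB_gt0 _ Ds); rewrite ?dvdB // ltnW.
have k_gt0 : (0 < k)%N.
  rewrite lt0n; apply: contra_not_neq nk1 => k0.
  move/eqP: k1; rewrite k0 eq_sym eqn_mod_dvd // subn0 dvdn1 => /eqP p1.
  by rewrite p1 in pr_p.
have k1_gt0 : (0 < k.-1)%N.
  by rewrite -subn1 subn_gt0 ltn_neqAle k_gt0 andbT; apply: contra_not_neq nk1 => <-.
have dvd_k1 c : (p ^ c %| k.-1)%N = (k == 1 %[mod p ^ c]).
  by rewrite eqn_mod_dvd // subn1.
have [c p'c Dk1] := pfactor_coprime pr_p k1_gt0.
set i := logn p k.-1 in Dk1.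
have i_gt0 : (0 < i)%N by rewrite -pfactor_dvdn // dvd_k1 expn1; apply/eqP.
have le_im : (i <= m)%N.
  by rewrite leqNgt -pfactor_dvdn // dvd_k1; apply/eqP.
rewrite prime_coprime // in p'c.
have l1i : l = 1 %[mod p ^ i].
  by rewrite -(modn_dvdm l (dvdn_exp2l p le_im)) l1 modn_dvdm ?dvdn_exp2l.
have [e De] := exp_approx B pr_p odd_p i_gt0 p'c l1i.
have {}De : k ^ e = l %[mod p ^ B].
  by rewrite -De -[k](prednK k_gt0) Dk1 mulnC.
have [w Dw] := aut_iter v e; exists w; split=> [x vx | z zb].
  by rewrite Dw iter_fix.
have zB : z ^+ (p ^ B) = 1 by rewrite expnD exprM zb expr1n.
by rewrite Dw (iter_exponent e Dv zB) Ds // -(expr_mod _ zB) De (expr_mod _ zB).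
Qed.

(** A rational number is fixed by complex conjugation, and the only real roots
of unity are 1 and -1. *)
Lemma rational_odd_root r n : rational_number r -> odd n -> r ^+ n = 1 -> r = 1.
Proof.
move=> rat_r odd_n rn1; have n_gt0 := odd_gt0 odd_n.
have real_r : r \is Num.real by rewrite CrealE; apply/eqP/(rat_r Num.conj).
have norm_r : `|r| = 1.
  by apply/eqP; rewrite -(@pexpr_eq1 _ _ n) ?normr_ge0 // -normrX rn1 normr1.
have [r_ge0 | r_lt0] := real_ge0P real_r.
  by rewrite -[r](ger0_norm r_ge0).
have Dr : r = -1 by rewrite -[r]opprK -(ltr0_norm r_lt0) norm_r.
move: rn1; rewrite Dr -signr_odd odd_n expr1 => /eqP.
by rewrite eq_sym -subr_eq0 opprK -mulr2n pnatr_eq0.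
Qed.

Lemma fixes_roots_iter p v b :
    prime p -> fixes_roots p v ->
  exists2 w : {rmorphism algC -> algC}, fixes_roots (p ^ b) w
    & forall x, w x = iter (p ^ b) v x.
Proof.
move=> pr_p fix_v; have [w Dw] := aut_iter v (p ^ b); exists w => //.
have pb_gt0 : (0 < p ^ b.+1)%N by rewrite expn_gt0 prime_gt0.
have [k _ Dv] := aut_exponent v pb_gt0.
have k1 : k = 1 %[mod p].
  by apply/(fixes_roots_exponent pb_gt0 _ Dv); rewrite // expnS dvdn_mulr.
have kpow j : k ^ (p ^ j) = 1 %[mod p ^ j.+1].
  elim: j => [|j IHj]; first by rewrite !expn1.
  have p_gt1 : (1 < p ^ j.+1)%N by rewrite (ltn_exp2l 0) ?prime_gt1.
  have [x Dx] : exists x, (k ^ (p ^ j) = 1 + p ^ j.+1 * x)%N.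
    exists (k ^ (p ^ j) %/ p ^ j.+1)%N.
    by rewrite {1}(divn_eq (k ^ (p ^ j)) (p ^ j.+1)) IHj modn_small // addnC mulnC.
  rewrite expnSr expnM Dx exp_one_plus_mod //.
  apply/eqP; rewrite -{2}[1%N]addn0 eqn_modDl mod0n.
  by rewrite -/(dvdn _ _) [(p ^ j.+2)%N]expnSr dvdn_mul ?dvdn_mull.
move=> z zb; have zb1 : z ^+ (p ^ b.+1) = 1 by rewrite expnSr exprM zb expr1n.
rewrite Dw (iter_exponent _ Dv zb1) -(expr_mod _ zb1) kpow.
by rewrite (expr_mod _ zb1) expr1.
Qed.

(** The stabilizer of the line spanned by [a] over the rationals acts trivially
on the [p]-th roots of unity. *)
Definition pins_roots p (a : algC) := forall v (r : algC),
  rational_number r -> v a = r * a -> fixes_roots p v.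

Lemma primitive_root_neq0 n (z : algC) : n.-primitive_root z -> z != 0.
Proof.
move=> pr_z; apply/eqP=> z0; move/eqP: (prim_expr_order pr_z).
by rewrite z0 expr0n gtn_eqF ?(prim_order_gt0 pr_z) // eq_sym oner_eq0.
Qed.

(** Suppose that [v] multiplies [a] by [r] and [v'] multiplies [zeta * a] by
[r']. Then [v'] multiplies [a] by [r' * e], where [e = zeta / v' zeta] is a
[p]-th root of unity. As [v] and [v'] commute on cyclotomic numbers, [v] fixes
[e]. If [v] moves some [p]-th root of unity, this forces [e = 1], so that [v']
fixes [zeta]. *)
Lemma pins_roots_or p zeta n w a :
    prime p -> p.-primitive_root zeta -> (0 < n)%N -> w ^+ n = 1 ->
    Qelt w a -> a != 0 ->
  pins_roots p a \/ pins_roots p (zeta * a).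
Proof.
move=> pr_p pr_zeta n_gt0 wn1 Qa nz_a.
have zetap := prim_expr_order pr_zeta.
have nz_zeta := primitive_root_neq0 pr_zeta.
have [good_a | bad_a] := classic (pins_roots p a); first by left.
right=> v' r' rat_r' Dv'; apply: NNPP => nfix_v'; apply: bad_a => v r rat_r Dv.
apply: NNPP => nfix_v.
have comm : v (v' a) = v' (v a).
  apply: (@Qadjoin_eq_rmorph (fun x => x = w) (v \o v') (v' \o v)) => // _ ->.
  exact: aut_unity_rootC wn1.
have [e De] : exists e, e = zeta / v' zeta by eexists.
have Dv'a : v' a = r' * e * a.
  have nz_v'z : v' zeta != 0 by rewrite fmorph_eq0.
  by move: Dv'; rewrite rmorphM /= => /(canRL (mulKf nz_v'z)) ->; rewrite De; field.
have ep : e ^+ p = 1.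
  by rewrite De expr_div_n -rmorphXn zetap rmorph1 divr1.
have nz_r' : r' != 0.
  apply: contraNneq nz_a => r'0; move/eqP: Dv'a.
  by rewrite r'0 !mul0r fmorph_eq0.
have nz_r : r != 0.
  by apply: contraNneq nz_a => r0; move/eqP: Dv; rewrite r0 mul0r fmorph_eq0.
have ve : v e = e.
  move: comm; rewrite Dv'a Dv !rmorphM /= Dv Dv'a rat_r rat_r' => comm.
  have nz : r' * r * a != 0 by rewrite !mulf_neq0.
  apply: (mulIf nz); transitivity (r' * v e * (r * a)); first by ring.
  by rewrite comm; ring.
have fix_pow (t : {rmorphism algC -> algC}) x : p.-primitive_root x -> t x = x ->
    fixes_roots p t.
  move=> pr_x tx z /(prim_rootP pr_x)[i ->]; by rewrite rmorphXn /= tx.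
have [e1 | ne1] := eqVneq e 1.
  apply: nfix_v'; apply: fix_pow pr_zeta _.
  by apply/esym/divr1_eq; rewrite -De.
by apply: nfix_v; apply: fix_pow ve; apply: prime_primitive_root.
Qed.

End RootsOfUnity.

(** * Values that determine the odd factors *)

(** Automorphisms that fix the [p]-th roots of unity act as a [p]-group on the
roots of unity of [p]-power order: this is the wild part of the action. *)
Definition wild_value gT (G : {group gT}) p (chi : 'CF(G)) (a : algC) : Prop :=
  a != 0 /\ forall v : {rmorphism algC -> algC},
    fixes_roots p v -> v a = a -> cfAut v chi = chi.

(** Rational factors are allowed because an automorphism that fixes a product
of values of special characters for distinct primes may multiply the single
values by rational numbers of product 1. *)
Definition robust_value gT (G : {group gT}) (chi : 'CF(G)) (a : algC) : Prop :=
  a != 0 /\ forall (v : {rmorphism algC -> algC}) (r : algC),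
    rational_number r -> v a = r * a -> cfAut v chi = chi.

(** Choose [m] such that all automorphisms fixing the [p ^ m.+1]-th roots of
unity fix ['chi_i], but some [s] fixing the [p ^ m]-th ones does not. If [v]
fixes the [p]-th roots of unity but not ['chi_i], then [s] acts on the values of
['chi_i] as a power of [v] ([aut_power_approx]). So if [v] fixed ['chi_i g],
then [s] would fix it too. *)
Lemma wild_value_detector gT (G : {group gT}) p (i : Iirr G) :
    solvable G -> prime p -> odd p -> pi_special p i ->
  exists2 L : 'CF(G), special_span p L /\ L != 0
    & forall g, L g != 0 -> wild_value p 'chi_i ('chi_i g).
Proof.
move=> solG pr_p odd_p p_i; pose b := logn p #|G|.
pose fixed m := forall v : {rmorphism algC -> algC},
  fixes_roots (p ^ m) v -> cfAut v 'chi_i = 'chi_i.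
have pb_gt0 : (0 < p ^ b)%N by rewrite expn_gt0 prime_gt0.
have [w pr_w] := C_prim_root_exists pb_gt0; have wb := prim_expr_order pr_w.
have pr_w' : (#|G|`_p).-primitive_root w by rewrite p_part.
have fixed_b : fixed b.
  by move=> v fix_v; apply: p_special_aut_fixed pr_w' (fix_v w wb).
have [fixed1 | nfixed1] := classic (fixed 1%N).
  exists 'chi_i => [|g nz_g]; first by split; [apply: pi_special_span | apply: irr_neq0].
  by split=> // v fix_v _; apply: fixed1; rewrite expn1.
have [m nfixed_m fixed_m1] : exists2 m, ~ fixed m & fixed m.+1.
  elim: b fixed_b {pb_gt0 pr_w pr_w' wb} => [fixed0 | c IHc fixed_c1].
    case: nfixed1 => v fix_v; apply: fixed0 => z; rewrite expn0 expr1 => ->.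
    by rewrite rmorph1.
  by have [/IHc | nfixed_c] := classic (fixed c); last by exists c.
have [s moved_s] := not_all_ex_not _ _ nfixed_m.
have [fix_s s_moves] := imply_to_and _ _ moved_s.
have nz_L : 'chi_i - cfAut s 'chi_i != 0.
  by apply/eqP => /eqP; rewrite subr_eq0 eq_sym => /eqP.
exists ('chi_i - cfAut s 'chi_i) => [|g nz_Lg].
  split=> // k; rewrite irr_consttE cfdotBl -aut_IirrE !cfdot_irr.
  have [<- // | _] := eqVneq i k; have [<- _ | _] := eqVneq (aut_Iirr s i) k.
    exact: pi_special_aut.
  by rewrite subrr eqxx.
rewrite !cfunE /= in nz_Lg.
split=> [|v fix_v vg].
  by apply/negP=> /eqP g0; case/negP: nz_Lg; rewrite g0 rmorph0 subrr.
apply: NNPP => v_moves; case/eqP: nz_Lg.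
have nfix_v : ~ fixes_roots (p ^ m.+1) v by move/fixed_m1.
have [t [fix_t Dt]] := aut_power_approx b pr_p odd_p fix_v nfix_v fix_s.
have Qg := p_special_Qelt g solG p_i pr_w'.
have -> : s ('chi_i g) = t ('chi_i g).
  by apply: Qadjoin_eq_rmorph Qg => _ ->; rewrite Dt.
by rewrite (fix_t _ vg) subrr.
Qed.

(** If [v] multiplies the value by [r], then it fixes the [p]-th roots of
unity, so a power of [v] of [p]-power exponent fixes the value. Hence [r] is a
rational root of unity of odd order, that is, [r = 1]. *)
Lemma robust_value_of_pins_roots gT (G : {group gT}) p (i : Iirr G) g :
    solvable G -> prime p -> odd p -> pi_special p i ->
    wild_value p 'chi_i ('chi_i g) -> pins_roots p ('chi_i g) ->
  robust_value 'chi_i ('chi_i g).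
Proof.
move=> solG pr_p odd_p p_i [nz_g wild_g] pins_g; split=> // v r rat_r Dv.
have fix_v := pins_g v r rat_r Dv.
have [w fix_w Dw] := fixes_roots_iter (logn p #|G|) pr_p fix_v.
have [z pr_z] := C_prim_root_exists (part_gt0 p #|G|).
have wg : w ('chi_i g) = 'chi_i g.
  rewrite -[in RHS](@p_special_aut_fixed _ _ _ _ _ w solG p_i pr_z) ?cfunE //.
  by apply: fix_w; rewrite -p_part prim_expr_order.
have iter_r e : iter e v ('chi_i g) = r ^+ e * 'chi_i g.
  elim: e => [|e IHe]; first by rewrite mul1r.
  by rewrite iterS IHe rmorphM rmorphXn /= rat_r Dv mulrA exprSr.
have r1 : r = 1.
  apply: (@rational_odd_root r (p ^ logn p #|G|)) => //; first by rewrite oddX odd_p orbT.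
  by apply: (mulIf nz_g); rewrite mul1r -iter_r -Dw wg.
by apply: wild_g => //; rewrite Dv r1 mul1r.
Qed.

(** The function [f] serves the induction: it carries the detectors of the
primes already removed from [R], and its nonvanishing is kept while the primes
in [R] are adjusted. *)
Lemma robust_values_exist gT (G : {group gT}) (psi : nat -> Iirr G) (R : seq nat) (f : 'CF(G)) :
    solvable G -> uniq R ->
    {in R, forall q, [/\ prime q, odd q, pi_special q (psi q) & psi q != 0]} ->
    special_span [pred q | q \notin R] f -> f != 0 ->
  exists2 g, f g != 0
    & {in R, forall q, robust_value 'chi_(psi q) ('chi_(psi q) g)}.
Proof.
move=> solG; have [n] := ubnP (size R); elim: n => // n IHn in R f *.
move=> leRn uniqR specR f_span nz_f.
have [R0 | ntR] := eqVneq R [::].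
  have /existsP[g nz_fg] : [exists g, f g != 0].
    apply: contraR nz_f => /existsPn f0; apply/eqP/cfunP=> g.
    by rewrite cfunE; apply/eqP; rewrite -[_ == _]negbK f0.
  by exists g; rewrite // R0.
have specR' : {in R, forall q, [/\ prime q, pi_special q (psi q) & psi q != 0]}.
  by move=> q /specR[].
have [p [D [N [z [zeta]]]]] := special_central_section solG ntR specR'.
case=> [[Rp nsNG nsDN abND pND]] kerN kerD Nz [pr_zeta mul_z].
have [pr_p odd_p p_i nz_p] := specR p Rp.
(* [p] is removed from [R], its detector [L] is added to [f], and [p] itself is
adjusted after the induction. *)
have [L [L_span nz_L] wildL] := wild_value_detector solG pr_p odd_p p_i.
have dis : {in [pred q | q \notin R], forall q, q \notin (p : nat_pred)}.
  by move=> q; apply: contra => /eqP->.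
have fL_span : special_span [pred q | q \notin rem p R] (f * L).
  apply: special_span_sub (special_span_mul solG dis f_span L_span) => q.
  rewrite !inE mem_rem_uniq // inE => /orP[R'q | /eqP->]; last by rewrite eqxx.
  by rewrite negb_and R'q orbT.
have nz_fL := special_span_mul_neq0 solG dis f_span L_span nz_f nz_L.
have [||q /mem_rem/specR//|g nz_fLg rob_g] := IHn (rem p R) (f * L) _ _ _ fL_span nz_fL.
- by rewrite size_rem // -ltnS prednK // lt0n size_eq0.
- exact: rem_uniq.
move: nz_fLg; rewrite cfunE mulf_eq0 negb_or => /andP[nz_fg /wildL wild_g].
have Gg : g \in G by apply: contraNT nz_fg => /cfun0->.
have rob q x : q \in R -> 'chi_(psi q) x = 'chi_(psi q) g -> q != p ->
    robust_value 'chi_(psi q) ('chi_(psi q) x).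
  by move=> Rq -> neq_qp; apply: rob_g; rewrite mem_rem_uniq // inE neq_qp.
have [w pr_w] := C_prim_root_exists (part_gt0 p #|G|).
have [nz_pg wild] := wild_g.
have [pins_g | pins_zg] := pins_roots_or pr_p pr_zeta (part_gt0 p #|G|)
    (prim_expr_order pr_w) (p_special_Qelt g solG p_i pr_w) nz_pg.
  exists g => // q Rq; have [-> | neq_qp] := eqVneq q p; last exact: rob.
  exact: robust_value_of_pins_roots solG pr_p odd_p p_i wild_g pins_g.
have pi'ND : ([pred q | q \notin R]^').-group (N / D).
  by apply: sub_in_pnat pND => q _ /eqP->; rewrite !inE negbK.
have [y zDy nz_fy] := special_span_coset_neq0 solG nsNG nsDN abND pi'ND f_span Gg Nz nz_fg.
have [d Dd Dy] := lcosetP zDy.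
have Ny : y \in N by rewrite Dy groupM // (subsetP (normal_sub nsDN)).
exists (g * y)%g => // q Rq; have [-> | neq_qp] := eqVneq q p; last first.
  by apply: rob => //; rewrite cfkerMr // (subsetP (kerN q Rq neq_qp)).
have Dpy : 'chi_(psi p) (g * y)%g = zeta * 'chi_(psi p) g.
  by rewrite Dy mulgA cfkerMr ?mul_z // (subsetP kerD).
apply: (robust_value_of_pins_roots solG pr_p odd_p p_i); rewrite Dpy //.
split=> [|v fix_v].
  by rewrite mulf_neq0 ?(primitive_root_neq0 pr_zeta).
rewrite rmorphM /= fix_v ?(prim_expr_order pr_zeta) //.
by move/(mulfI (primitive_root_neq0 pr_zeta)); apply: wild.
Qed.

(** * The 2-special factor *)

Lemma p_special_cfIirr gT (G : {group gT}) p (psi : 'CF(G)) :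
    prime p -> p_special p psi ->
  'chi_(cfIirr psi) = psi /\ pi_special p (cfIirr psi).
Proof.
move=> pr_p [irr_psi [k Dk] ord_psi]; have Dpsi := cfIirrE irr_psi.
split=> //; split; rewrite Dpsi; first by rewrite Dk natrK pnatX pnat_id.
by move=> S nnSG j /(ord_psi S nnSG)[e ->]; rewrite pnatX pnat_id.
Qed.

Lemma special_span_prod gT (G : {group gT}) (psi : nat -> Iirr G) (s : seq nat) :
    solvable G -> uniq s -> {in s, forall q : nat, pi_special q (psi q)} ->
  special_span [pred q | q \in s] (\prod_(q <- s) 'chi_(psi q)).
Proof.
move=> solG; elim: s => [|q s IHs] /=.
  move=> _ _ i; rewrite big_nil -irr0 constt_irr => /eqP->.
  exact: pi_special0.
case/andP=> s'q uniq_s spec_s; rewrite big_cons.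
have dis : {in (q : nat_pred), forall r, r \notin [pred q | q \in s]}.
  by move=> r /eqP->.
apply: special_span_sub (special_span_mul solG dis _ (IHs uniq_s _)) => [r||r sr].
- by rewrite !inE.
- by apply: pi_special_span; apply: spec_s; apply: mem_head.
by apply: spec_s; rewrite inE sr orbT.
Qed.

Definition determined_at gT (G : {group gT}) (chi : 'CF(G)) g : Prop :=
  chi g != 0 /\ forall v : {rmorphism algC -> algC},
    v (chi g) = chi g -> cfAut v chi = chi.

(** If ['chi_i] has order [p * h], the detector is
['chi_i - 'chi_i ^+ h.+1]: where it does not vanish, the value of ['chi_i] is a
primitive root of unity of order [p * h], so it generates all the values. *)
Lemma lin_value_detector gT (G : {group gT}) p (i : Iirr G) :
    prime p -> pi_special p i -> 'chi_i \is a linear_char ->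
  exists2 L : 'CF(G), special_span p L /\ L != 0
    & forall g, g \in G -> L g != 0 -> determined_at 'chi_i g.
Proof.
move=> pr_p p_i lin_i.
have nz_val g : g \in G -> 'chi_i g != 0 by move=> Gg; apply: lin_char_neq0.
have [i1 | ni1] := eqVneq 'chi_i 1.
  exists 'chi_i => [|g Gg _].
    by split; [apply: pi_special_span | apply: irr_neq0].
  by split=> [|v _]; [apply: nz_val | rewrite i1 cfAut_cfun1].
have := pi_special_det p_i; rewrite cfDet_order_lin // => /p_natP[b Db].
case: b Db => [|b] Db.
  by case/eqP: ni1; rewrite -['chi_i]expr1 -(expn0 p) -Db exp_cforder.
pose h := (p ^ b)%N.
have lin_k : 'chi_i ^+ h.+1 \is a linear_char by rewrite rpredX.
have [k Dk] := irrP (lin_char_irr lin_k).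
have p_k : pi_special p k.
  apply: pi_special_lin; rewrite -Dk //.
  apply: (@pnat_dvd _ #['chi_i]%CF); last by rewrite Db pnatX pnat_id.
  by rewrite dvdn_cforder exprAC exp_cforder expr1n.
have neq_ik : i != k.
  apply/eqP=> ik; have : 'chi_i ^+ h = 1.
    have u_i := lin_char_unitr lin_i.
    by apply: (mulrI u_i); rewrite -exprS Dk ik mulr1.
  move/eqP; rewrite -dvdn_cforder Db /h => /dvdn_leq.
  by rewrite expn_gt0 prime_gt0 // leq_exp2l ?prime_gt1 // ltnn => /(_ isT).
exists ('chi_i - 'chi_k) => [|g Gg nz_Lg].
  split; last by rewrite subr_eq0 (inj_eq irr_inj).
  move=> j; rewrite irr_consttE cfdotBl !cfdot_irr.
  have [<- // | _] := eqVneq i j; have [<- _ // | _] := eqVneq k j.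
  by rewrite subrr eqxx.
split=> [|v vg]; first exact: nz_val.
have prim_g : (p ^ b.+1).-primitive_root ('chi_i g).
  have gN : 'chi_i g ^+ (p ^ b.+1) = 1 by apply/(dvdn_cforderP _ g Gg); rewrite Db.
  have [m pr_m] : {m | m.-primitive_root ('chi_i g) & m %| p ^ b.+1}%N.
    by apply: prim_order_exists; rewrite // expn_gt0 prime_gt0.
  case/(dvdn_pfactor _ _ pr_p)=> e; rewrite leq_eqVlt => /orP[/eqP-> <- // | lt_eb Dm].
  case/negP: nz_Lg; rewrite !cfunE -Dk exp_cfunE // exprS.
  suffices -> : 'chi_i g ^+ h = 1 by rewrite mulr1 subrr.
  by apply/eqP; rewrite -(prim_order_dvd pr_m) Dm dvdn_exp2l.
apply/cfun_inP=> x Gx; rewrite cfunE /=.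
have xN : 'chi_i x ^+ (p ^ b.+1) = 1 by apply/(dvdn_cforderP _ x Gx); rewrite Db.
by have [e ->] := prim_rootP prim_g xN; rewrite rmorphXn /= vg.
Qed.

Lemma p_special_aut_agree gT (G : {group gT}) (p : nat) (i : Iirr G)
    (u v : {rmorphism algC -> algC}) :
    solvable G -> pi_special p i ->
    (forall z : algC, z ^+ #|G|`_p = 1 -> u z = v z) ->
  cfAut u 'chi_i = cfAut v 'chi_i.
Proof.
move=> solG p_i eq_uv; have [w pr_w] := C_prim_root_exists (part_gt0 p #|G|).
apply/cfunP=> x; rewrite !cfunE /=.
apply: (Qadjoin_eq_rmorph _ (p_special_Qelt x solG p_i pr_w)) => _ ->.
by rewrite eq_uv ?prim_expr_order.
Qed.

Lemma p_special_aut_id gT (G : {group gT}) (p : nat) (i : Iirr G)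
    (u : {rmorphism algC -> algC}) :
    solvable G -> pi_special p i -> fixes_roots #|G|`_p u ->
  cfAut u 'chi_i = 'chi_i.
Proof.
move=> solG p_i fix_u; have [w pr_w] := C_prim_root_exists (part_gt0 p #|G|).
by apply: (p_special_aut_fixed solG p_i pr_w); rewrite fix_u ?prim_expr_order.
Qed.

Lemma fixes_roots_dvd m n (v : {rmorphism algC -> algC}) :
  (m %| n)%N -> fixes_roots n v -> fixes_roots m v.
Proof.
by case/dvdnP=> d -> fix_v z zm; apply: fix_v; rewrite mulnC exprM zm expr1n.
Qed.

Lemma dvdn_part_p' n (p q : nat) : q != p -> (n`_q %| n`_p^')%N.
Proof.
by move=> neq_qp; apply: sub_in_partn => r _ /eqP->; rewrite !inE.
Qed.

(** The automorphism that agrees with [v] on roots of unity of 2-power order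
and is trivial on those of odd order fixes [chi] and its factors for odd primes,
so it fixes the 2-special factor by uniqueness of the factors. *)
Lemma two_rational_factor gT (G : {group gT}) (psi : nat -> Iirr G) (chi : 'CF(G)) :
    solvable G -> {in primes #|G|, forall q : nat, pi_special q (psi q)} ->
    chi = \prod_(q <- primes #|G|) 'chi_(psi q) -> chi \in irr G ->
    two_rational chi -> (2 \in primes #|G|)%N ->
  forall v : {rmorphism algC -> algC}, cfAut v 'chi_(psi 2) = 'chi_(psi 2).
Proof.
move=> solG spec Dchi irr_chi [m [w [odd_m pr_w Qchi]]] G2 v.
have nm_gt0 : (0 < #|G| * m)%N by rewrite muln_gt0 cardG_gt0 odd_gt0.
have [t [t_v fix_t]] := aut_pi_part 2%N v nm_gt0.
have m_2' : (m %| (#|G| * m)`_2^')%N.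
  rewrite partnM ?cardG_gt0 ?(odd_gt0 odd_m) // dvdn_mull //.
  by rewrite part_pnat_id // -odd_2'nat.
have tchi : cfAut t chi = chi.
  apply/cfunP=> x; rewrite cfunE /=; have [Gx | /cfun0->] := boolP (x \in G); last exact: rmorph0.
  have Qx : Qelt w (chi x) by apply: Qchi; apply: Qadjoin_gen; exists x.
  apply: (@Qadjoin_eq_rmorph (fun y => y = w) t idfun) Qx => _ ->.
  exact: fixes_roots_dvd m_2' fix_t w (prim_expr_order pr_w).
have part_nm q : (#|G|`_q %| (#|G| * m)`_q)%N by rewrite partn_dvd ?dvdn_mulr.
have -> : cfAut v 'chi_(psi 2) = cfAut t 'chi_(psi 2).
  apply: (p_special_aut_agree solG (spec 2%N G2)) => z z2; rewrite t_v //.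
  by case/dvdnP: (part_nm 2%N) => d ->; rewrite mulnC exprM z2 expr1n.
pose X := \prod_(q <- rem 2%N (primes #|G|)) 'chi_(psi q).
have DX : chi = 'chi_(psi 2) * X by rewrite Dchi (big_rem 2%N).
have uniq_rem : uniq (rem 2%N (primes #|G|)) by rewrite rem_uniq ?primes_uniq.
have X_span := special_span_prod solG uniq_rem (sub_in1 (@mem_rem _ 2%N _) spec).
have tX : cfAut t X = X.
  rewrite /X rmorph_prod !big_seq; apply: eq_bigr => q.
  rewrite mem_rem_uniq ?primes_uniq // inE => /andP[neq_q2 Gq].
  apply: (p_special_aut_id solG (spec q Gq)); apply: fixes_roots_dvd fix_t.
  exact: dvdn_trans (part_nm q) (dvdn_part_p' _ neq_q2).
have dis : {in (2%N : nat_pred), forall q, q \notin [pred q | q \in rem 2%N (primes #|G|)]}.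
  by move=> q /eqP->; rewrite inE mem_rem_uniq ?primes_uniq // inE eqxx.
have := cfdot_special_prod solG dis (pi_special_span (spec 2%N G2))
  (pi_special_span (pi_special_aut t (spec 2%N G2))) X_span X_span.
have tDX : cfAut t 'chi_(psi 2%N) * X = chi.
  by rewrite -[RHS]tchi DX rmorphM /= tX.
rewrite -/X aut_IirrE tDX -DX.
have /irrP[c ->] := irr_chi; rewrite cfnorm_irr -aut_IirrE cfdot_irr.
case: eqP => [<- // | _ /eqP]; by rewrite mul0r oner_eq0.
Qed.

(** * The field generated by one value *)

Lemma odd_degree_factor_lin gT (G : {group gT}) (psi : nat -> Iirr G) (chi : 'CF(G)) n :
    chi = \prod_(q <- primes #|G|) 'chi_(psi q) -> (2 \in primes #|G|)%N ->
    pi_special 2%N (psi 2) -> odd n -> chi 1%g = n%:R ->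
  'chi_(psi 2) \is a linear_char.
Proof.
move=> Dchi G2 [two_d _] odd_n; rewrite Dchi (big_rem 2%N) //= cfunE.
set X := \prod_(q <- _) _; have NX : X \is a character.
  by apply: rpred_prod => q _; apply: irr_char.
have /natrP[e ->] := Cnat_char1 NX; have /natrP[d Dd] := Cnat_irr1 (psi 2).
rewrite Dd natrK in two_d; rewrite Dd -natrM => /eqP; rewrite eqr_nat => /eqP Dn.
have odd_d : odd d by move: odd_n; rewrite -Dn oddM => /andP[].
have [[|k] Dk] := p_natP two_d; last by rewrite Dk oddX in odd_d.
by rewrite qualifE /= irr_char Dd Dk expn0 eqxx.
Qed.

Lemma two_part_detector gT (G : {group gT}) (psi : nat -> Iirr G) (chi : 'CF(G)) :
    solvable G -> {in primes #|G|, forall q : nat, pi_special q (psi q)} ->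
    chi = \prod_(q <- primes #|G|) 'chi_(psi q) -> chi \in irr G ->
    two_rational chi \/ (exists2 n : nat, odd n & chi 1%g = n%:R) ->
  exists2 L : 'CF(G), special_span 2%N L /\ L != 0
    & (2 \in primes #|G|)%N ->
      forall g, g \in G -> L g != 0 -> determined_at 'chi_(psi 2) g.
Proof.
move=> solG spec Dchi irr_chi chi_2.
have [G2 | G'2] := boolP (2%N \in primes #|G|); last first.
  exists 1 => //; split; last by rewrite oner_eq0.
  by rewrite -irr0; apply: pi_special_span; apply: pi_special0.
have spec2 := spec 2%N G2.
case: chi_2 => [two_rat | [n odd_n chi1]].
  exists 'chi_(psi 2) => [|_ g Gg nz_g].
    by split; [apply: pi_special_span | apply: irr_neq0].
  by split=> // v _; apply: two_rational_factor Dchi irr_chi two_rat G2 v.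
have lin2 := odd_degree_factor_lin Dchi G2 spec2 odd_n chi1.
by have [L L_span seen] := lin_value_detector (isT : prime 2) spec2 lin2; exists L.
Qed.

(** To see that [r p] is rational, take any automorphism [s] and the [t] that
agrees with [s] on roots of unity of [p]-power order and is trivial on those of
order prime to [p]. Then [s] and [t] agree on [r p], while [t] fixes the other
[r q], hence also [r p], the inverse of their product. *)
Lemma galois_determining_value gT (G : {group gT}) (psi : nat -> Iirr G) (chi : 'CF(G)) g :
    solvable G -> {in primes #|G|, forall q : nat, pi_special q (psi q)} ->
    chi = \prod_(q <- primes #|G|) 'chi_(psi q) -> g \in G ->
    {in primes #|G|, forall q, odd q -> robust_value 'chi_(psi q) ('chi_(psi q) g)} ->
    ((2 \in primes #|G|)%N -> determined_at 'chi_(psi 2) g) ->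
  forall u : {rmorphism algC -> algC}, u (chi g) = chi g -> cfAut u chi = chi.
Proof.
move=> solG spec Dchi Gg robust seen2 u ug; pose a q := 'chi_(psi q) g.
have nz_a q : q \in primes #|G| -> a q != 0.
  move=> Gq; have [pr_q _ _] := and3P (etrans (esym (mem_primes q #|G|)) Gq).
  have [Dq | odd_q] := even_prime pr_q; last by have [] := robust q Gq odd_q.
  by rewrite Dq in Gq *; have [] := seen2 Gq.
pose r q := u (a q) / a q.
have nz_r q : q \in primes #|G| -> r q != 0.
  by move/nz_a => nz; rewrite mulf_neq0 ?invr_eq0 ?fmorph_eq0.
have Dr q : q \in primes #|G| -> u (a q) = r q * a q.
  by move/nz_a => nz; rewrite divfK.
have prod_a : chi g = \prod_(q <- primes #|G|) a q.
  by rewrite Dchi prod_cfunE.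
have prod_r : \prod_(q <- primes #|G|) r q = 1.
  have nz_chi : chi g != 0 by rewrite prod_a prodf_seq_neq0; apply/allP=> q /nz_a.
  apply: (mulIf nz_chi); rewrite mul1r -[RHS]ug prod_a -big_split rmorph_prod /=.
  by rewrite !big_seq; apply: eq_bigr => q /Dr.
have Dr' p : p \in primes #|G| -> r p = (\prod_(q <- rem p (primes #|G|)) r q)^-1.
  move=> Gp; have nz_rest : \prod_(q <- rem p (primes #|G|)) r q != 0.
    by rewrite prodf_seq_neq0; apply/allP=> q /mem_rem/nz_r.
  by apply: (mulIf nz_rest); rewrite mulVf // -[RHS]prod_r [RHS](big_rem p).
have ua q : u (a q) = 'chi_(aut_Iirr u (psi q)) g by rewrite aut_IirrE cfunE.
have rat_r (p : nat) : p \in primes #|G| -> rational_number (r p).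
  move=> Gp s; have [t [t_s fix_t]] := aut_pi_part p s (cardG_gt0 G).
  have spec_p := spec p Gp; have spec_up := pi_special_aut u spec_p.
  have agree (i : Iirr G) : pi_special p i -> s ('chi_i g) = t ('chi_i g).
    move=> p_i; have := p_special_aut_agree solG p_i (fun z zp => esym (t_s z zp)) => /cfunP/(_ g).
    by rewrite !cfunE.
  have -> : s (r p) = t (r p).
    by rewrite /r ua !fmorph_div /= !agree.
  rewrite (Dr' p Gp) fmorphV rmorph_prod /=; congr (_^-1).
  rewrite !big_seq; apply: eq_bigr => q; rewrite mem_rem_uniq ?primes_uniq //.
  rewrite inE => /andP[neq_qp Gq].
  have fix_q : fixes_roots #|G|`_q t := fixes_roots_dvd (dvdn_part_p' _ neq_qp) fix_t.
  have fix_val (i : Iirr G) : pi_special q i -> t ('chi_i g) = 'chi_i g.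
    move=> q_i; have := p_special_aut_id solG q_i fix_q => /cfunP/(_ g).
    by rewrite cfunE.
  by rewrite /r ua fmorph_div /= !fix_val //; [apply: spec | apply/pi_special_aut/spec].
have fix_odd q : q \in primes #|G| -> odd q -> cfAut u 'chi_(psi q) = 'chi_(psi q).
  move=> Gq odd_q; have [_ rob] := robust q Gq odd_q.
  exact: rob (rat_r q Gq) (Dr q Gq).
have fix_all q : q \in primes #|G| -> cfAut u 'chi_(psi q) = 'chi_(psi q).
  move=> Gq; have [pr_q _ _] := and3P (etrans (esym (mem_primes q #|G|)) Gq).
  have [Dq | odd_q] := even_prime pr_q; last exact: fix_odd.
  rewrite {}Dq in Gq *; have [_ seen] := seen2 Gq; apply: seen.
  rewrite -/(a 2%N) Dr // (Dr' _ Gq) big_seq big1 ?invr1 ?mul1r // => p.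
  rewrite mem_rem_uniq ?primes_uniq // inE => /andP[neq_p2 Gp].
  have [pr_p _ _] := and3P (etrans (esym (mem_primes p #|G|)) Gp).
  have odd_p : odd p by have [Dp | //] := even_prime pr_p; rewrite Dp in neq_p2.
  have /cfunP/(_ g) := fix_odd p Gp odd_p; rewrite cfunE /= => up.
  by rewrite /r /a up divff // nz_a.
by rewrite Dchi rmorph_prod /= !big_seq; apply: eq_bigr => q /fix_all.
Qed.

Theorem theoremA (gT : finGroupType) (G : {group gT}) (chi : 'CF(G))
    (solG : solvable G) (irr_chi : chi \in irr G)
    (fact_chi : fully_factorizable chi)
    (chi_2rat_or_odd :
       two_rational chi \/ exists2 n : nat, odd n & chi 1%g = n%:R) :
  exists2 g : gT, g \in G & forall x : algC, Qelt (chi g) x <-> Qchar chi x.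
Proof.
have [phi [spec_phi Dchi]] := fact_chi.
pose psi q := cfIirr (phi q).
have prG q : q \in primes #|G| -> prime q by rewrite mem_primes => /and3P[].
have specE q : q \in primes #|G| -> 'chi_(psi q) = phi q /\ pi_special q (psi q).
  by move=> Gq; apply: p_special_cfIirr; [apply: prG | apply: spec_phi].
have spec : {in primes #|G|, forall q : nat, pi_special q (psi q)}.
  by move=> q /specE[].
have {}Dchi : chi = \prod_(q <- primes #|G|) 'chi_(psi q).
  by rewrite Dchi !big_seq; apply: eq_bigr => q /specE[].
have [L [L_span nz_L] seen2] := two_part_detector solG spec Dchi irr_chi chi_2rat_or_odd.
(* A trivial factor has the value 1 at every element, and no element acts on it
as a primitive root of unity of prime order. *)
pose R := [seq q <- primes #|G| | odd q && (psi q != 0)].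
have uniqR : uniq R by rewrite filter_uniq ?primes_uniq.
have specR : {in R, forall q, [/\ prime q, odd q, pi_special q (psi q) & psi q != 0]}.
  by move=> q; rewrite mem_filter => /andP[/andP[odd_q nz_q] Gq]; split; auto.
have L_spanR : special_span [pred q | q \notin R] L.
  by apply: special_span_sub L_span => q /eqP->; rewrite inE mem_filter.
have [g nz_Lg robR] := robust_values_exist solG uniqR specR L_spanR nz_L.
have Gg : g \in G by apply: contraNT nz_Lg => /cfun0->.
exists g => // x; split; apply: Qadjoin_trans => {x}.
  by move=> _ ->; apply: Qadjoin_gen; exists g.
move=> _ [h Gh ->]; have [z pr_z] := C_prim_root_exists (cardG_gt0 G).
have Nchi := irrWchar irr_chi.
apply: (Qelt_descent pr_z); try by apply: Qelt_char pr_z Nchi _; apply: order_dvdG.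
move=> u ug; suffices /cfunP/(_ h) : cfAut u chi = chi by rewrite cfunE.
apply: (galois_determining_value solG spec Dchi Gg) ug => [q Gq odd_q|G2]; last first.
  exact: seen2.
have [Rq | ] := boolP (q \in R); first exact: robR.
rewrite mem_filter odd_q Gq andbT negbK => /eqP->; rewrite irr0.
by split=> [|v r _ _]; [rewrite cfun1E Gg oner_eq0 | apply: cfAut_cfun1].
Qed.
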